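(* Let $E=\mathbb R^n$ with the Euclidean metric and Lebesgue measure. Let $k\ge0$ be Borel measurable on $\mathbb R^n\times\mathbb R^n\setminus\{(x,x)\}$, $k_s(x,y)=\tfrac12(k(x,y)+k(y,x))$, $k_a(x,y)=\tfrac12(k(x,y)-k(y,x))$. Suppose $$x\mapsto\int_{y\neq x}(1\wedge|y-x|^2)k_s(x,y)\,dy\in L^2_{\mathrm{loc}}(dx),\qquad x\mapsto\int_{0<|z|\le1}|z|\,|k_s(x,x+z)-k_s(x,x-z)|\,dz\in L^2_{\mathrm{loc}}(dx),$$ $$x\mapsto\int_{\{y:\,|y-x|\ge1\}}k_s(x,y)\,dy\in L^2(dx)\cup L^\infty(dx),$$ $$\sup_{x\in\mathbb R^n}\int_{\{k_s(x,y)\neq0\}}\frac{k_a(x,y)^2}{k_s(x,y)}\,dy<\infty,\qquad \int_{0<|x-y|\le1}|x-y|\,|k_a(x,y)|\,dy<\infty\ \text{ for all }x.$$ Let $(\eta,\mathscr F^0)$ be the regular lower bounded semi-Dirichlet form on $L^2(\mathbb R^n)$ associated with $k$, and let $(L,D(L))$ be its generator. Then $C_c^2(\mathbb R^n)\subset D(L)$, and for $u\in C_c^2(\mathbb R^n)$, $$\begin{aligned}Lu(x)&=\int_{z\neq0}\big(u(x+z)-u(x)-\nabla u(x)\cdot z\,\mathbf 1_{\{|z|\le1\}}\big)k_s(x,x+z)\,dz\\&\quad+\tfrac12\nabla u(x)\cdot\int_{0<|z|\le1}z\big(k_s(x,x+z)-k_s(x,x-z)\big)\,dz+\int_{y\neq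 x}(u(y)-u(x))k_a(x,y)\,dy.\end{aligned}$$
   Context: $C_c^{\mathrm{lip}}(\mathbb R^n)$ denotes the compactly supported Lipschitz functions. Let $\mathscr E(u,v)=\iint_{y\neq x}(u(x)-u(y))(v(x)-v(y))k_s(x,y)\,dx\,dy$, $\mathscr F^r=\{u\in L^2(\mathbb R^n):\mathscr E(u,u)<\infty\}$, and let $\mathscr F^0$ be the closure of $C_c^{\mathrm{lip}}(\mathbb R^n)$ in $\mathscr F^r$ for the norm $(\mathscr E(u,u)+\|u\|_{L^2}^2)^{1/2}$. The form $\eta$ is defined for $u,v\in C_c^{\mathrm{lip}}(\mathbb R^n)$ by $\eta(u,v)=\frac12\mathscr E(u,v)+\iint_{y\neq x}(u(x)-u(y))v(y)k_a(x,y)\,dx\,dy$ (equivalently $\eta(u,v)=\lim_{n\to\infty}-\int\big(\int_{|x-y|>1/n}(u(y)-u(x))k(x,y)\,dy\big)v(x)\,dx$) and extended by continuity to $\mathscr F^0\times\mathscr F^0$; under the hypotheses it is a regular lower bounded semi-Dirichlet form. Its generator is the operator $L$ with domain $D(L)=\{u\in\mathscr F^0: v\mapsto\eta(u,v)\text{ is continuous on }\mathscr F^0\text{ w.r.t. }\|\cdot\|_{L^2}\}$ mapping $D(L)$ into $L^2(\mathbb R^n)$ with $\eta(u,v)=-\langle Lu,v\rangle_{L^2}$ for $u\in D(L)$, $v\in\mathscr F^0$. *)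

(* Defs.v *)
From HB Require Import structures.
From mathcomp Require Import all_boot all_order all_algebra.
From mathcomp Require Import all_classical all_reals all_analysis measurable_realfun.
Set Implicit Arguments. Unset Strict Implicit. Unset Printing Implicit Defensive.
Import Order.TTheory GRing.Theory Num.Theory.
Import numFieldNormedType.Exports.
Local Open Scope classical_set_scope.
Local Open Scope ring_scope.

Definition rV_borel_display : measure_display. Proof. exact. Qed.

Section BorelRn.
Variables (R : realType) (n : nat).
Definition borel_rV : set (set 'rV[R]_n) := <<s [set A | open A] >>.
Let b0 : borel_rV set0. Proof. exact: sigma_algebra0. Qed.
Let bC A : borel_rV A -> borel_rV (~` A). Proof. exact: sigma_algebraC. Qed.
Let bU (F : (set 'rV[R]_n)^nat) : (forall i, borel_rV (F i)) ->
  borel_rV (\bigcup_i F i).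
Proof. exact: sigma_algebra_bigcup. Qed.
HB.instance Definition _ := @isMeasurable.Build rV_borel_display 'rV[R]_n
  borel_rV b0 bC bU.
End BorelRn.

Section Defs.
Variables (R : realType) (n : nat).
Local Notation V := 'rV[R]_n.
Implicit Types (mu : {measure set V -> \bar R}) (k : V -> V -> R) (u v f : V -> R).

Definition enorm (x : V) : R := Num.sqrt (\sum_(i < n) x ord0 i ^+ 2).
Definition ei (i : 'I_n) : V := delta_mx ord0 i.

Definition is_lebesgue mu : Prop :=
  forall a b : V, (forall i, a ord0 i <= b ord0 i) ->
    mu [set x | forall i, a ord0 i <= x ord0 i <= b ord0 i] =
    (\prod_(i < n) (b ord0 i - a ord0 i))%:E.

Definition ks k x y := (k x y + k y x) / 2.
Definition ka k x y := (k x y - k y x) / 2.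

Definition L2 mu f : Prop :=
  measurable_fun setT f /\ (\int[mu]_x ((f x) ^+ 2)%:E < +oo)%E.
Definition L2e mu (g : V -> \bar R) : Prop :=
  measurable_fun setT g /\ (\int[mu]_x (g x * g x) < +oo)%E.
Definition L2loc mu (g : V -> \bar R) : Prop :=
  measurable_fun setT g /\
  forall r : R, (\int[mu]_(x in [set x | (enorm x <= r)%R]) (g x * g x) < +oo)%E.
Definition Linfty mu (g : V -> \bar R) : Prop :=
  measurable_fun setT g /\
  exists M : R, {ae mu, forall x, (abse (g x) <= M%:E)%E}.

Definition compact_support f : Prop :=
  exists r : R, forall x, r < enorm x -> f x = 0.
Definition Cc_lip f : Prop :=
  compact_support f /\ exists C : R, forall x y, `|f x - f y| <= C * enorm (x - y).

Definition partial (i : 'I_n) f : V -> R := fun x => 'D_(ei i) f x.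
Definition C2 f : Prop :=
  continuous f /\
  (forall i x, derivable f x (ei i)) /\ (forall i, continuous (partial i f)) /\
  (forall i j x, derivable (partial i f) x (ei j)) /\
  (forall i j, continuous (partial j (partial i f))).
Definition C2c f : Prop := compact_support f /\ C2 f.
Definition grad_dot f x (z : V) : R := \sum_(i < n) partial i f x * z ord0 i.

Definition Eform mu k u v : \bar R :=
  (\int[mu]_x \int[mu]_(y in [set y | y != x])
      ((u x - u y) * (v x - v y) * ks k x y)%:E)%E.
Definition Fnorm2 mu k u : \bar R :=
  (Eform mu k u u + \int[mu]_x ((u x) ^+ 2)%:E)%E.
Definition Fconv mu k (us : nat -> V -> R) u : Prop :=
  forall e : R, 0 < e -> exists N, forall m, (N <= m)%N ->
    (Fnorm2 mu k (fun x => (us m x - u x)%R) < e%:E)%E.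
Definition F0 mu k u : Prop :=
  L2 mu u /\ (Eform mu k u u < +oo)%E /\
  exists us, (forall m, Cc_lip (us m)) /\ Fconv mu k us u.

Definition eta_lip mu k u v : R :=
  fine (Eform mu k u v) / 2 +
  fine (\int[mu]_x \int[mu]_(y in [set y | y != x])
      ((u x - u y) * v y * ka k x y)%:E)%E.
(* eta(u,v) = l for u, v in F^0 : value of the extension by continuity *)
Definition eta_ext mu k u v (l : R) : Prop :=
  forall us vs, (forall m, Cc_lip (us m)) -> (forall m, Cc_lip (vs m)) ->
    Fconv mu k us u -> Fconv mu k vs v ->
    eta_lip mu k (us m) (vs m) @[m --> \oo] --> l.
(* u in D(L) and Lu = f (as elements of L^2) *)
Definition generator_value mu k u f : Prop :=
  F0 mu k u /\ L2 mu f /\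
  forall v, F0 mu k v -> eta_ext mu k u v (- Rintegral mu setT (fun x => f x * v x)).

Definition Lformula mu k u (x : V) : R :=
  Rintegral mu [set z | z != 0]
    (fun z => (u (x + z) - u x - grad_dot u x z * (if enorm z <= 1 then 1 else 0)) * ks k x (x + z))
  + 2^-1 * \sum_(i < n) (partial i u x *
      Rintegral mu [set z | 0 < enorm z <= 1]
        (fun z => z ord0 i * (ks k x (x + z) - ks k x (x - z))))
  + Rintegral mu [set y | y != x] (fun y => (u y - u x) * ka k x y).
End Defs.

(* Main.v *)
(* Truncate to |z| > 1/(k+1), where the integrand (u(x+z) - u(x)) v(x) k_s(x,x+z) is
   integrable.  Symmetry of k_s gives (1/2) E_k(u,v) = - int v(x) (u(x+z) - u(x)) k_s there,
   and the gradient term may be symmetrised in z -> -z; after subtracting and adding back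
   grad u(x).z 1_{|z| <= 1}, every term is dominated by an integrable function (Taylor's
   formula and the hypotheses on k_s), so k -> oo yields eta(u,v) = - <Lu,v> for u in C^2_c
   and v in C_c^lip.  The antisymmetric term is absolutely convergent by Cauchy-Schwarz:
   (u(x)-u(y)) v(y) k_a = [(u(x)-u(y)) sqrt(k_s)] [v(y) k_a / sqrt(k_s)].  The same
   inequalities bound eta(u,v)^2 by a multiple of |u|^2 |v|^2 in the energy norm, and the
   formula for Lu defines an L^2 function, so the identity passes to the limit. *)

Require Import Defs.
From HB Require Import structures.
From mathcomp Require Import all_boot all_order all_algebra.
From mathcomp Require Import all_classical all_reals all_analysis measurable_realfun.
From mathcomp Require Import ring lra.
Import Order.TTheory GRing.Theory Num.Theory.
Import numFieldNormedType.Exports.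
Set Implicit Arguments.
Unset Strict Implicit.
Unset Printing Implicit Defensive.
Local Open Scope classical_set_scope.
Local Open Scope ring_scope.

(** * Borel sets and Lebesgue measure on row vectors *)

(** The kernel carries no information on the diagonal, so the analysis runs on its modification that
    is 0 there; every integral is then over the whole space. Truncated identities are pointwise
    identities on the product space, in the coordinates (x, z) with y = x + z, followed by a
    measure-preserving change of variables: (x, z) -> (x + z, -z) exchanges x and y, and (x, z) ->
    (x, -z) symmetrises the gradient term. All of this rests on translation and reflection
    invariance of [mu], which has to be derived from its values on boxes. Slice integrals in the
    formula may diverge at exceptional points, where the real-valued integral is 0 by convention;
    the identities are therefore proved after multiplying by v and integrating, and v also localises
    x. Square integrability of Lu is a global statement. Outside a large ball u and its gradient
    vanish at x, so the symmetric part reduces to the integral of u(x+z) k_s over jumps with |z| >=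
    1, which the tail hypothesis controls. *)

Lemma open_measurable_rV (R : realType) (n : nat) (A : set 'rV[R]_n) :
  open A -> measurable A.
Proof. by move=> oA; exact: sub_sigma_algebra. Qed.

Lemma continuous_measurable_rV (R : realType) (n : nat) (f : 'rV[R]_n -> R) :
  continuous f -> measurable_fun setT f.
Proof.
move=> cf; apply: (@measurability _ _ _ _ setT f (@RGenOInfty.G R)).
  exact: RGenOInfty.measurableE.
move=> _ [_ [a ->] <-]; rewrite setTI; apply: open_measurable_rV.
by apply: open_comp.
Qed.

Definition open_box (R : realType) (n : nat) (a b : 'I_n -> rat) : set 'rV[R]_n :=
  [set x | forall i, ratr (a i) < x ord0 i < ratr (b i)].

Lemma open_box_sub (R : realType) (n : nat) (A : set 'rV[R]_n) (x : 'rV[R]_n) :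
  open A -> A x ->
  exists a b : {ffun 'I_n -> rat}, @open_box R n a b x /\ @open_box R n a b `<=` A.
Proof.
move=> oA Ax; have /nbhs_ballP[e /= e0 eA] : nbhs x A by exact: open_nbhs_nbhs.
have hex i : exists q : rat * rat, x ord0 i - e < ratr q.1 < x ord0 i /\
    x ord0 i < ratr q.2 < x ord0 i + e.
  have [p] : exists p, ratr p \in `]x ord0 i - e, x ord0 i[ by apply: rat_in_itvoo; lra.
  have [q] : exists q, ratr q \in `]x ord0 i, x ord0 i + e[ by apply: rat_in_itvoo; lra.
  by rewrite !in_itv /= => qx px; exists (p, q).
have [f fP] := choice hex.
exists [ffun i => (f i).1], [ffun i => (f i).2]; split.
  by move=> i; rewrite !ffunE; have [] := fP i; lra.
move=> y yab; apply: eA; split=> // i j; rewrite (ord1 i).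
have := yab j; have := fP j; rewrite !ffunE /ball /= ltr_distlC.
by move=> [? ?] ?; lra.
Qed.

(** Rational corners leave countably many open boxes. An open set is the union of those it contains,
    and the preimage of a box is a finite intersection of conditions on coordinates. *)
Lemma measurable_fun_rV d (T : measurableType d) (R : realType) (n : nat)
    (f : T -> 'rV[R]_n) :
  (forall i, measurable_fun setT (fun t => f t ord0 i)) -> measurable_fun setT f.
Proof.
move=> mf; apply: (@measurability _ _ _ _ setT f [set A : set 'rV[R]_n | open A]) => //.
move=> _ [A oA <-]; rewrite setTI.
(* Boxes not contained in [A] contribute [set0], so the union runs over a whole countable type. *)
have -> : f @^-1` A = \bigcup_(p : {ffun 'I_n -> rat} * {ffun 'I_n -> rat})
    (if `[< @open_box R n p.1 p.2 `<=` A >] then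
      \bigcap_(i in [set: 'I_n]) [set t | ratr (p.1 i) < f t ord0 i < ratr (p.2 i)]
     else set0).
  apply/seteqP; split => t /=.
    move=> /(open_box_sub oA)[a [b [abt abA]]]; exists (a, b) => //=.
    by rewrite asboolT// => i _; exact: abt.
  by move=> [[a b] _ /=]; case: asboolP => // abA abt; apply: abA => i; exact: abt.
apply: countable_bigcupT_measurable => [|[a b]]; first exact: countableP.
case: ifPn => _ //=; apply: fin_bigcap_measurable => // i _.
have := mf i measurableT `]ratr (a i), ratr (b i)[%classic.
rewrite setTI; have -> : (fun t => f t ord0 i) @^-1` `]ratr (a i), ratr (b i)[ =
  [set t | ratr (a i) < f t ord0 i < ratr (b i)].
  by apply/seteqP; split => t /=; rewrite in_itv.
by apply; exact: measurable_itv.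
Qed.

Lemma measurable_coord (R : realType) (n : nat) (i : 'I_n) :
  measurable_fun setT (fun x : 'rV[R]_n => x ord0 i).
Proof. by apply: continuous_measurable_rV; exact: coord_continuous. Qed.

Lemma measurable_fun_coord d (T : measurableType d) (R : realType) (n : nat)
    (f : T -> 'rV[R]_n) i :
  measurable_fun setT f -> measurable_fun setT (fun t => f t ord0 i).
Proof. by move=> mf; exact: (measurableT_comp (measurable_coord i)). Qed.

Lemma measurable_fun_addV d (T : measurableType d) (R : realType) (n : nat)
    (f g : T -> 'rV[R]_n) :
  measurable_fun setT f -> measurable_fun setT g ->
  measurable_fun setT (fun t => f t + g t).
Proof.
move=> mf mg; apply: measurable_fun_rV => i.
under eq_fun do rewrite mxE.
by apply: measurable_funD; exact: measurable_fun_coord.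
Qed.

Lemma measurable_fun_oppV d (T : measurableType d) (R : realType) (n : nat)
    (f : T -> 'rV[R]_n) :
  measurable_fun setT f -> measurable_fun setT (fun t => - f t).
Proof.
move=> mf; apply: measurable_fun_rV => i.
under eq_fun do rewrite mxE.
by apply: measurableT_comp => //; exact: measurable_fun_coord.
Qed.

Lemma continuous_enorm (R : realType) (n : nat) : continuous (@enorm R n).
Proof.
suff cs (s : seq 'I_n) : continuous (fun y : 'rV[R]_n => \sum_(i <- s) y ord0 i ^+ 2).
  move=> x; apply: (continuous_comp (cs _ x)); exact: sqrt_continuous.
elim: s => [|i s IHs] x.
  have -> : (fun y : 'rV[R]_n => \sum_(i <- [::]) y ord0 i ^+ 2) = cst 0.
    by apply/funext => y; rewrite big_nil.
  exact: cst_continuous.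
have -> : (fun y : 'rV[R]_n => \sum_(j <- i :: s) y ord0 j ^+ 2) =
    (fun y => y ord0 i * y ord0 i + \sum_(j <- s) y ord0 j ^+ 2).
  by apply/funext => y; rewrite big_cons expr2.
apply: (continuousD (f := fun y : 'rV[R]_n => y ord0 i * y ord0 i)); last exact: IHs.
by apply: continuousM; exact: coord_continuous.
Qed.

Lemma enorm_ge0 (R : realType) (n : nat) (x : 'rV[R]_n) : 0 <= enorm x.
Proof. exact: sqrtr_ge0. Qed.

Lemma coord_le_enorm (R : realType) (n : nat) (x : 'rV[R]_n) i :
  `|x ord0 i| <= enorm x.
Proof.
rewrite -sqrtr_sqr ler_sqrt; last by apply: sumr_ge0 => j _; rewrite sqr_ge0.
by rewrite (bigD1 i)//= lerDl sumr_ge0// => j _; rewrite sqr_ge0.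
Qed.

Lemma enormN (R : realType) (n : nat) (x : 'rV[R]_n) : enorm (- x) = enorm x.
Proof. by congr Num.sqrt; apply: eq_bigr => i _; rewrite mxE sqrrN. Qed.

Lemma enorm0 (R : realType) (n : nat) : enorm (0 : 'rV[R]_n) = 0.
Proof. by rewrite /enorm big1 ?sqrtr0// => i _; rewrite mxE expr0n. Qed.

Lemma enorm_eq0 (R : realType) (n : nat) (x : 'rV[R]_n) : (enorm x == 0) = (x == 0).
Proof.
apply/idP/idP => [/eqP x0|/eqP->]; last by rewrite enorm0.
apply/eqP/rowP => i; rewrite mxE; apply/eqP.
by rewrite -normr_le0 -x0 coord_le_enorm.
Qed.

Lemma measurable_fun_enorm d (T : measurableType d) (R : realType) (n : nat)
    (f : T -> 'rV[R]_n) :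
  measurable_fun setT f -> measurable_fun setT (fun t => enorm (f t)).
Proof.
move=> mf; apply: (measurableT_comp (f := @enorm R n)) => //.
by apply: continuous_measurable_rV; exact: continuous_enorm.
Qed.

(** * Lebesgue measure determined by its values on closed boxes *)

Section lebesgue.
Context (R : realType) (n : nat).
Local Notation V := 'rV[R]_n.

Definition closed_box (a b : V) : set V :=
  [set x | forall i, a ord0 i <= x ord0 i <= b ord0 i].

Definition closed_boxes : set (set V) := [set A | exists a b, A = closed_box a b].

Lemma closed_box_measurable a b : measurable (closed_box a b).
Proof.
have -> : closed_box a b = \bigcap_(i in [set: 'I_n])
    ((fun x : V => x ord0 i) @^-1` `[a ord0 i, b ord0 i]).
  apply/seteqP; split => x /=; first by move=> h i _ /=; rewrite in_itv; exact: h.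
  by move=> h i; have := h i I; rewrite /= in_itv.
apply: fin_bigcap_measurable => // i _; rewrite -[X in measurable X]setTI.
by apply: measurable_coord => //; exact: measurable_itv.
Qed.

Lemma closed_boxesI : setI_closed closed_boxes.
Proof.
move=> _ _ [a [b ->]] [c [d ->]].
exists (\row_i Num.max (a ord0 i) (c ord0 i)), (\row_i Num.min (b ord0 i) (d ord0 i)).
apply/seteqP; split => x /=.
  move=> [xab xcd] i; rewrite !mxE ge_max le_min.
  by have /andP[-> ->] := xab i; have /andP[-> ->] := xcd i.
by move=> h; split => i; have := h i; rewrite !mxE ge_max le_min; lra.
Qed.

(** It suffices that the identity from the box sigma-algebra to the Borel one is measurable. By the
    coordinate criterion this only involves open half-spaces, each a countable union of closed
    boxes. *)
Lemma closed_boxes_generate (A : set V) : measurable A -> <<s closed_boxes >> A.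
Proof.
move=> mA; pose T := g_sigma_algebraType closed_boxes.
suff : measurable_fun (setT : set T) (id : T -> V).
  by move=> /(_ measurableT _ mA); rewrite setTI.
apply: measurable_fun_rV => i.
apply: (@measurability _ _ _ _ setT _ (@RGenOInfty.G R)).
  exact: RGenOInfty.measurableE.
move=> _ [_ [r ->] <-]; rewrite setTI.
have -> : (fun t : T => (t : V) ord0 i) @^-1` `]r, +oo[ =
  \bigcup_(k : nat) closed_box (\row_j if j == i then r + k.+1%:R^-1 else - k%:R) (\row_j k%:R).
  apply/seteqP; split => x /=.
    rewrite in_itv /= andbT => rx.
    (* The first summand makes 1/(k+1) at most x_i - r; the second makes k exceed every |x_j|. *)
    exists (Num.bound (x ord0 i - r)^-1 + Num.bound (enorm x))%N => // j.
    have xj := coord_le_enorm x j.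
    have b1 := archi_boundP (enorm_ge0 x).
    have b2 : (x ord0 i - r)^-1 < (Num.bound (x ord0 i - r)^-1)%:R.
      by apply: archi_boundP; rewrite invr_ge0 subr_ge0 ltW.
    have n0 := ler0n R (Num.bound (x ord0 i - r)^-1).
    have n1 := ler0n R (Num.bound (enorm x)).
    rewrite !mxE; apply/andP; split; last first.
      by rewrite natrD; move: xj; rewrite ler_norml => /andP[_ xj]; lra.
    case: eqP => [->|_].
      rewrite -lerBrDl invf_ple ?posrE ?subr_gt0//.
      by rewrite mulrSr natrD; lra.
    by rewrite natrD; move: xj; rewrite ler_norml => /andP[xj _]; lra.
  move=> [k _ /(_ i)]; rewrite !mxE eqxx in_itv /= andbT => /andP[h _].
  by apply: lt_le_trans h; rewrite ltrDl.
apply: bigcupT_measurable => k; apply: sub_sigma_algebra.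
by eexists; eexists; reflexivity.
Qed.

Definition cube (N : nat) : set V := closed_box (\row_j - N%:R) (\row_j N%:R).

Lemma cube_cover : \bigcup_N cube N = setT.
Proof.
apply/seteqP; split => // x _; exists (Num.bound (enorm x)) => // i.
have := coord_le_enorm x i; have := archi_boundP (enorm_ge0 x).
by rewrite !mxE ler_norml => b /andP[? ?]; lra.
Qed.

Section lebesgue_measure.
Variables (mu : {measure set V -> \bar R}).
Hypothesis Hmu : is_lebesgue mu.

Lemma is_lebesgue_cube N : (mu (cube N) < +oo)%E.
Proof.
rewrite Hmu ?ltry// => i; rewrite !mxE.
by rewrite (@le_trans _ _ 0)// oppr_le0.
Qed.

Lemma is_lebesgue_sigma_finite : sigma_finite setT mu.
Proof.
exists cube; first by rewrite cube_cover.
by move=> N; split; [exact: closed_box_measurable|exact: is_lebesgue_cube].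
Qed.

(* The closed boxes are a generating pi-system, so invariance is only checked on them. *)
Lemma is_lebesgue_pushforward (phi : V -> V) (mphi : measurable_fun setT phi)
  (g : V -> V -> V) (h : V -> V -> V) :
  (forall a b : V, phi @^-1` closed_box a b = closed_box (g a b) (h a b)) ->
  (forall a b : V, (forall i, a ord0 i <= b ord0 i) ->
    (forall i, g a b ord0 i <= h a b ord0 i) /\
    \prod_(i < n) (h a b ord0 i - g a b ord0 i) = \prod_(i < n) (b ord0 i - a ord0 i)) ->
  forall A, measurable A -> mu (phi @^-1` A) = mu A.
Proof.
move=> phiE gh A mA.
pose phiM : {mfun V >-> V} := HB.pack phi (isMeasurableFun.Build _ _ _ _ phi mphi).
have closed_boxE (a b : V) : ~ (forall i, a ord0 i <= b ord0 i) ->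
    closed_box a b = set0.
  move=> ab; apply/seteqP; split => // x xab; apply: ab => i.
  by have /andP[] := xab i; exact: le_trans.
apply/esym.
apply: (@g_sigma_algebra_measure_unique _ R V closed_boxes _ cube _ _ mu
  (pushforward mu phiM) closed_boxesI) => //.
- by move=> _ [a [b ->]]; exact: closed_box_measurable.
- by move=> N; eexists; eexists; reflexivity.
- exact: cube_cover.
- move=> _ [a [b ->]]; rewrite -[RHS]/(mu (phi @^-1` closed_box a b)) phiE.
  have [ab|ab] := pselect (forall i, a ord0 i <= b ord0 i).
    by have [gh1 gh2] := gh _ _ ab; rewrite !Hmu// gh2.
  rewrite -phiE closed_boxE ?preimage_set0//.
- exact: is_lebesgue_cube.
- exact: closed_boxes_generate.
Qed.

Lemma is_lebesgue_shift (c : V) A : measurable A ->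
  mu ((fun x => c + x) @^-1` A) = mu A.
Proof.
apply: (@is_lebesgue_pushforward _ _ (fun a _ => a - c) (fun _ b => b - c)).
- by apply: measurable_fun_addV; [exact: measurable_cst|exact: measurable_id].
- move=> a b; apply/seteqP; split => x /= h i; have := h i; rewrite !mxE; lra.
- move=> a b ab; split=> [i|]; first by rewrite !mxE lerD2r.
  by apply: eq_bigr => i _; rewrite !mxE; ring.
Qed.

Lemma is_lebesgue_opp (A : set V) : measurable A -> mu ((fun x : V => - x) @^-1` A) = mu A.
Proof.
apply: (@is_lebesgue_pushforward _ _ (fun _ b => - b) (fun a _ => - a)).
- by apply: measurable_fun_oppV; exact: measurable_id.
- move=> a b; apply/seteqP; split => x /= h i; have := h i; rewrite !mxE; lra.
- move=> a b ab; split=> [i|]; first by rewrite !mxE lerN2.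
  by apply: eq_bigr => i _; rewrite !mxE; ring.
Qed.
End lebesgue_measure.
End lebesgue.

(** * Second-order Taylor estimate from continuous partial derivatives *)

Section partial_derivatives.
Context (R : realType) (n : nat).
Local Notation V := 'rV[R]_n.
Implicit Types f u : V -> R.

Lemma is_derive_line f x i t : derivable f (x + t *: ei R i) (ei R i) ->
  is_derive t (1 : R) (fun t => f (x + t *: ei R i)) (partial i f (x + t *: ei R i)).
Proof.
move=> df.
have E : (fun h : R => h^-1 *: (f (x + (h *: (1 : R) + t) *: ei R i) - f (x + t *: ei R i))) =
         (fun h : R => h^-1 *: (f (h *: ei R i + (x + t *: ei R i)) - f (x + t *: ei R i))).
  by apply/funext => h; rewrite scalerDl [h *: 1]mulr1 addrCA.
by apply: DeriveDef; rewrite /derivable /derive /partial /= E.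
Qed.

Lemma partial_mvt f x i (t : R) : (forall y, derivable f y (ei R i)) ->
  exists c, `|c| <= `|t| /\
    f (x + t *: ei R i) - f x = partial i f (x + c *: ei R i) * t.
Proof.
move=> df.
have H y (s : R) : 0 <= s -> exists2 c, 0 <= c <= s &
    f (y + s *: ei R i) - f y = partial i f (y + c *: ei R i) * s.
  move=> s0.
  have := @MVT_segment R (fun t => f (y + t *: ei R i))
    (fun t => partial i f (y + t *: ei R i)) 0 s s0.
  have dl r : is_derive r (1 : R) (fun t => f (y + t *: ei R i)) (partial i f (y + r *: ei R i)).
    exact: is_derive_line.
  case=> // [|c].
    by apply: derivable_within_continuous => r _; have [] := dl r.
  by rewrite in_itv /= scale0r addr0 subr0 => c0s E; exists c.
have [t0|t0] := leP 0 t.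
  have [c /andP[c0 ct] E] := H x t t0; exists c; split => //.
  by rewrite !ger0_norm.
(* For negative t the segment is traversed from its other end. *)
have [|c /andP[c0 ct]] := H (x + t *: ei R i) (- t); first lra.
rewrite -!addrA -!scalerDl subrr scale0r addr0 => E.
exists (t + c); split; last by rewrite -opprB E mulrN opprK.
by rewrite !ler0_norm ?lerN2; lra.
Qed.

(* Moving one coordinate at a time, the mean value theorem only needs partial derivatives. *)
Lemma coordinate_path f (x z : V) : (forall i y, derivable f y (ei R i)) ->
  exists xi : 'I_n -> V, (forall i j, `|(xi i - x) ord0 j| <= `|z ord0 j|) /\
    f (x + z) - f x = \sum_(i < n) partial i f (xi i) * z ord0 i.
Proof.
move=> df.
pose zk (k : nat) : V := \row_j if (j < k)%N then z ord0 j else 0.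
have zS (i : 'I_n) : zk i.+1 = zk i + z ord0 i *: ei R i.
  apply/rowP => j; rewrite !mxE eqxx /= ltnS leq_eqVlt.
  have [->|ij] := eqVneq j i; first by rewrite eqxx ltnn mulr1 add0r.
  by rewrite -(inj_eq val_inj) in ij; rewrite (negbTE ij) mulr0 addr0.
have H (i : 'I_n) := partial_mvt (x + zk i) (z ord0 i) (df i).
have [c cP] := choice H.
exists (fun i : 'I_n => x + zk i + c i *: ei R i); split.
  move=> i j; rewrite addrAC [x + _]addrC addrK !mxE eqxx /=.
  have [->|ij] := eqVneq j i; first by rewrite ltnn add0r mulr1; exact: (cP i).1.
  by rewrite mulr0 addr0; case: ifP; rewrite ?normr0.
have -> : f (x + z) - f x = f (x + zk n) - f (x + zk 0%N).
  congr (f _ - f _).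
    by congr (x + _); apply/rowP => j; rewrite mxE ltn_ord.
  by rewrite (_ : zk 0%N = 0) ?addr0//; apply/rowP => j; rewrite !mxE.
rewrite -(telescope_sumr (fun k => f (x + zk k)))// big_mkord.
by apply: eq_bigr => i _; rewrite zS addrA; exact: (cP i).2.
Qed.

Lemma sum_coord_le (z : V) : \sum_(i < n) `|z ord0 i| <= n%:R * enorm z.
Proof.
rewrite -[n in n%:R]card_ord -sumr_const mulr_suml ler_sum// => i _.
by rewrite mul1r coord_le_enorm.
Qed.

Lemma enorm_le_coord (y z : V) : (forall j, `|y ord0 j| <= `|z ord0 j|) ->
  enorm y <= enorm z.
Proof.
move=> yz; rewrite ler_sqrt; last by apply: sumr_ge0 => i _; rewrite sqr_ge0.
by apply: ler_sum => i _; rewrite -(real_normK (num_real (y _ _))) -(real_normK (num_real (z _ _))) lerXn2r ?nnegrE.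
Qed.

Lemma partial_lipschitz f M (x z : V) : 0 <= M -> (forall i y, derivable f y (ei R i)) ->
  (forall i y, `|partial i f y| <= M) ->
  `|f (x + z) - f x| <= M * n%:R * enorm z.
Proof.
move=> M0 df fM; have [xi [_ ->]] := coordinate_path x z df.
apply: le_trans (ler_norm_sum _ _ _) _.
apply: (@le_trans _ _ (M * \sum_(i < n) `|z ord0 i|)).
  by rewrite mulr_sumr ler_sum// => i _; rewrite normrM ler_wpM2r.
by rewrite -mulrA ler_wpM2l// sum_coord_le.
Qed.

(** The points given by [coordinate_path] are within [enorm z] of x, so [partial_lipschitz], applied
    to each first partial derivative, supplies the second factor [enorm z]. Each of the two uses of
    [sum_coord_le] costs a factor n. *)
Lemma partial_taylor2 f M (x z : V) : 0 <= M -> (forall i y, derivable f y (ei R i)) ->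
  (forall i j y, derivable (partial i f) y (ei R j)) ->
  (forall i j y, `|partial j (partial i f) y| <= M) ->
  `|f (x + z) - f x - grad_dot f x z| <= M * n%:R * n%:R * enorm z ^+ 2.
Proof.
move=> M0 df ddf fM; have [xi [xiz ->]] := coordinate_path x z df.
rewrite /grad_dot -sumrB; apply: le_trans (ler_norm_sum _ _ _) _.
apply: (@le_trans _ _ (\sum_(i < n) (M * n%:R * enorm z) * `|z ord0 i|)).
  apply: ler_sum => i _; rewrite -mulrBl normrM ler_wpM2r//.
  have -> : xi i = x + (xi i - x) by rewrite addrC subrK.
  apply: le_trans (partial_lipschitz _ _ M0 (ddf i) (fM i)) _.
  by rewrite ler_wpM2l ?mulr_ge0// enorm_le_coord.
rewrite -mulr_sumr.
have -> : M * n%:R * n%:R * enorm z ^+ 2 = M * n%:R * enorm z * (n%:R * enorm z) by ring.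
by rewrite ler_wpM2l ?mulr_ge0 ?enorm_ge0// sum_coord_le.
Qed.

Lemma compact_support_bounded f : compact_support f -> continuous f ->
  exists M, forall x, `|f x| <= M.
Proof.
move=> [r fr] cf.
(* The absolute value keeps this cube nonempty when [r] is negative; outside it f vanishes. *)
pose A := [set v : V | forall i, `[- `|r|, `|r|]%classic (v ord0 i)].
have cA : compact A by apply: (@rV_compact _ _ (fun=> `[- `|r|, `|r|]%classic)) => i; exact: segment_compact.
have A0 : A !=set0.
  by exists 0 => i /=; rewrite in_itv /= mxE oppr_le0 normr_ge0.
have [c cA' cmax] : exists2 c, c \in A & forall t, t \in A -> `|f t| <= `|f c|.
  apply: (@EVT_max_rV R n (fun t => `|f t|) A) => //; apply: continuous_subspaceT => x.
  by apply: (continuous_comp (g := fun r : R => `|r|)); [exact: cf|exact: norm_continuous].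
exists `|f c| => x; have [xA|] := boolP (x \in A); first exact: cmax.
rewrite notin_setE => xA; rewrite fr ?normr0//; rewrite ltNge; apply/negP => xr.
apply: xA => i /=; rewrite in_itv /= -ler_norml.
by rewrite (le_trans (coord_le_enorm _ _))// (le_trans xr)// ler_norm.
Qed.

Lemma partial_support f r i : (forall x, r < enorm x -> f x = 0) ->
  forall x, r < enorm x -> partial i f x = 0.
Proof.
move=> fr x rx; have nx : \forall y \near x, f y = cst 0 y.
  have : \forall y \near x, r < enorm y.
    apply: (@continuous_enorm R n x [set t | r < t]).
    by apply: open_nbhs_nbhs; split => //; exact: open_gt.
  by apply: filterS => y; exact: fr.
by rewrite /partial (near_eq_derive _ nx) derive_cst.
Qed.

Lemma C2c_bounds u : C2c u -> exists r C, [/\ 0 <= C,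
  forall x, r < enorm x -> u x = 0,
  (forall i x, r < enorm x -> partial i u x = 0),
  forall x, `|u x| <= C &
  [/\ forall i x, `|partial i u x| <= C,
      forall x z, `|u (x + z) - u x| <= C * enorm z &
      forall x z, `|u (x + z) - u x - grad_dot u x z| <= C * enorm z ^+ 2]].
Proof.
move=> [[r ur] [cu [du [cpu [ddu cppu]]]]].
have pr i := partial_support i ur.
have ppr i j := partial_support j (pr i).
have [C0 C0P] := compact_support_bounded (ex_intro _ r ur) cu.
have [C1 C1P] := choice (fun i => compact_support_bounded (ex_intro _ r (pr i)) (cpu i)).
have [C2 C2P] := choice (fun ij : 'I_n * 'I_n => compact_support_bounded
  (ex_intro _ r (ppr ij.1 ij.2)) (cppu ij.1 ij.2)).
pose A := `|C0| + \sum_i `|C1 i| + \sum_ij `|C2 ij|.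
have A0 : 0 <= A by rewrite !addr_ge0// sumr_ge0.
have A1 i : C1 i <= A.
  rewrite (le_trans (ler_norm _))// /A (bigD1 i)//=.
  have : 0 <= \sum_(j < n | j != i) `|C1 j| by rewrite sumr_ge0.
  have : 0 <= \sum_ij `|C2 ij| by rewrite sumr_ge0.
  have := normr_ge0 C0; lra.
have A2 ij : C2 ij <= A.
  rewrite (le_trans (ler_norm _))// /A [X in _ + X](bigD1 ij)//=.
  have : 0 <= \sum_(j | j != ij) `|C2 j| by rewrite sumr_ge0.
  have : 0 <= \sum_i `|C1 i| by rewrite sumr_ge0.
  have := normr_ge0 C0; lra.
have bp i x : `|partial i u x| <= A by rewrite (le_trans (C1P _ _)).
have bpp i j x : `|partial j (partial i u) x| <= A by rewrite (le_trans (C2P (i, j) _)).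
(* The last factor absorbs the n and n^2 of the Lipschitz and Taylor estimates, so that one constant
   serves all bounds. *)
pose C := A * (1 + n%:R + n%:R * n%:R).
have n0 : 0 <= (n%:R : R) by [].
have AC : A <= C by rewrite /C; nra.
exists r, C; split => //; first exact: le_trans AC.
  move=> x; apply: le_trans (C0P x) _; apply: le_trans AC.
  apply: le_trans (ler_norm _) _.
  by rewrite /A -addrA lerDl addr_ge0// sumr_ge0.
split.
- by move=> i x; exact: le_trans AC.
- move=> x z; apply: le_trans (partial_lipschitz _ _ A0 du bp) _.
  by rewrite ler_wpM2r ?enorm_ge0// /C; nra.
- move=> x z; apply: le_trans (partial_taylor2 _ _ A0 du ddu bpp) _.
  by rewrite ler_wpM2r ?sqr_ge0// /C; nra.
Qed.

Lemma C2c_Cc_lip u : C2c u -> Cc_lip u.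
Proof.
move=> hu; have [r [C [C0 ur _ _ [_ uC _]]]] := C2c_bounds hu.
split; first by exists r.
by exists C => x y; have := uC y (x - y); rewrite [y + _]addrC subrK.
Qed.


(** The Lipschitz condition is Euclidean while the topology of row vectors comes from the maximum
    norm; continuity of [enorm] bridges the two. *)
Lemma Cc_lip_continuous (v : V -> R) : Cc_lip v -> continuous v.
Proof.
move=> [_ [C vC]] x A /nbhs_ballP[e /= e0 eA].
have C1 : 0 < `|C| + 1 by rewrite ltr_wpDl.
have : \forall y \near x, enorm (x - y) < e / (`|C| + 1).
  have : continuous (fun y : V => enorm (x - y)).
    move=> y; apply: (continuous_comp (f := fun y : V => x - y)); last exact: continuous_enorm.
    by apply: continuousB; [exact: cst_continuous|exact: cvg_id].
  move=> /(_ x [set t | t < e / (`|C| + 1)]); apply.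
  apply: open_nbhs_nbhs; split; first exact: open_lt.
  by rewrite /= subrr enorm0 divr_gt0.
apply: filterS => y xy; apply: eA; apply: le_lt_trans (vC x y) _.
apply: le_lt_trans (ler_wpM2r (enorm_ge0 _) (ler_norm C)) _.
rewrite ltr_pdivlMr// in xy; have := enorm_ge0 (x - y); nra.
Qed.
End partial_derivatives.

(** * Integration tools *)

Section integration.
Context d (T : measurableType d) (R : realType).
Variable m : {measure set T -> \bar R}.
Implicit Types f g : T -> R.

Lemma integrable_ge0_lty f : measurable_fun setT f -> (forall x, 0 <= f x) ->
  (\int[m]_x (f x)%:E < +oo)%E -> m.-integrable setT (EFin \o f).
Proof.
move=> mf f0 foo; apply/integrableP; split; first exact/measurable_EFinP.
by under eq_integral do rewrite /= ger0_norm//.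
Qed.

Lemma integrable_le f g : measurable_fun setT f ->
  (forall x, `|f x| <= g x) -> m.-integrable setT (EFin \o g) ->
  m.-integrable setT (EFin \o f).
Proof.
move=> mf fg; apply: le_integrable => //; first exact/measurable_EFinP.
by move=> x _; rewrite /= lee_fin (le_trans (fg x))// ler_norm.
Qed.

Lemma integrable_measurable f : m.-integrable setT (EFin \o f) -> measurable_fun setT f.
Proof. by move=> /integrableP[/measurable_EFinP]. Qed.

Lemma Rintegral_EFin f : m.-integrable setT (EFin \o f) ->
  (\int[m]_x (f x)%:E = (Rintegral m setT f)%:E)%E.
Proof. by move=> mf; rewrite fineK//; exact: integrable_fin_num. Qed.

(* The discriminant of the nonnegative quadratic [t |-> \int (f + t g)^2]. *)
Lemma cauchy_schwarz f g : measurable_fun setT f -> measurable_fun setT g ->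
  m.-integrable setT (EFin \o (fun x => f x ^+ 2)) ->
  m.-integrable setT (EFin \o (fun x => g x ^+ 2)) ->
  m.-integrable setT (EFin \o (fun x => f x * g x)) /\
  (Rintegral m setT (fun x => f x * g x)) ^+ 2 <=
    Rintegral m setT (fun x => f x ^+ 2) * Rintegral m setT (fun x => g x ^+ 2).
Proof.
move=> mf mg f2 g2.
have fg : m.-integrable setT (EFin \o (fun x => f x * g x)).
  apply: (@integrable_le _ (fun x => f x ^+ 2 + g x ^+ 2)).
  - exact: measurable_funM.
  - by move=> x; rewrite normrM -(real_normK (num_real (f x))) -(real_normK (num_real (g x))); nra.
  - by apply: eq_integrable (integrableD measurableT f2 g2).
split => //.
set A := Rintegral _ _ (fun x => f x ^+ 2); set C := Rintegral _ _ (fun x => g x ^+ 2).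
set B := Rintegral _ _ _.
have C0 : 0 <= C by apply: Rintegral_ge0 => x _; exact: sqr_ge0.
have H t : 0 <= A + t * (2 * B) + t ^+ 2 * C.
  have i1 : m.-integrable setT (EFin \o (fun x => t * (2 * (f x * g x)))).
    have := integrableZl measurableT (t * 2) fg.
    by apply: eq_integrable => // x _ /=; rewrite -EFinM -!mulrA.
  have i2 : m.-integrable setT (EFin \o (fun x => t ^+ 2 * g x ^+ 2)).
    exact: (integrableZl measurableT (t ^+ 2) g2).
  have -> : A + t * (2 * B) + t ^+ 2 * C =
      Rintegral m setT (fun x => f x ^+ 2 + t * (2 * (f x * g x)) + t ^+ 2 * g x ^+ 2).
    rewrite RintegralD// ?RintegralD//.
    - rewrite RintegralZl// ?RintegralZl// ?RintegralZl//.
      exact: (integrableZl measurableT 2 fg).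
    - exact: (integrableD measurableT f2 i1).
  apply: Rintegral_ge0 => x _.
  have -> : f x ^+ 2 + t * (2 * (f x * g x)) + t ^+ 2 * g x ^+ 2 = (f x + t * g x) ^+ 2 by ring.
  exact: sqr_ge0.
have [C00|C0'] := eqVneq C 0.
  rewrite C00 mulr0; have [->|B0] := eqVneq B 0; first by rewrite expr0n.
  (* Without its quadratic term the polynomial is affine in t, and this t gives it the value -1. *)
  have := H (- (A + 1) / (2 * B)); rewrite C00 mulr0 addr0 divfK ?mulf_neq0//; lra.
have Cp : 0 < C by rewrite lt_neqAle eq_sym C0'.
have := H (- B / C).
have -> : A + - B / C * (2 * B) + (- B / C) ^+ 2 * C = A - B ^+ 2 / C by field.
by rewrite subr_ge0 ler_pdivrMr.
Qed.

Lemma Rintegral_dominated (f_ : nat -> T -> R) f g :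
  (forall k, measurable_fun setT (f_ k)) -> measurable_fun setT f ->
  (forall x, f_ ^~ x @ \oo --> f x) ->
  m.-integrable setT (EFin \o g) -> (forall k x, `|f_ k x| <= g x) ->
  Rintegral m setT (f_ k) @[k --> \oo] --> Rintegral m setT f.
Proof.
move=> mf_ mf ff ig fg.
have h1 : forall k, measurable_fun setT (EFin \o f_ k).
  by move=> k; exact/measurable_EFinP.
have h2 : measurable_fun setT (EFin \o f) by exact/measurable_EFinP.
have h3 : {ae m, forall x, setT x -> (EFin \o f_ k) x @[k --> \oo] --> (EFin \o f) x}.
  by apply: aeW => x _; apply: cvg_EFin; [apply: nearW|exact: ff].
have h4 : {ae m, forall x k, setT x -> (`|(EFin \o f_ k) x| <= (EFin \o g) x)%E}.
  by apply: aeW => x k _ /=; rewrite lee_fin.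
have [if0 _ h] := dominated_convergence measurableT h1 h2 h3 ig h4.
by apply: fine_cvg; rewrite -Rintegral_EFin.
Qed.

(** Invariance is phrased through integrals of nonnegative functions, the form in which Tonelli's
    theorem verifies it on a product. *)
Definition preserving (phi : T -> T) := measurable_fun setT phi /\
  forall f : T -> \bar R, measurable_fun setT f -> (forall x, 0 <= f x)%E ->
    (\int[m]_x f (phi x) = \int[m]_x f x)%E.

Lemma preserving_integral phi (f : T -> \bar R) : preserving phi ->
  measurable_fun setT f -> (\int[m]_x f (phi x) = \int[m]_x f x)%E.
Proof.
move=> [mphi H] mf; rewrite integralE [RHS]integralE.
congr (_ - _)%E.
- transitivity (\int[m]_x f^\+ (phi x))%E; first by apply: eq_integral => x _; rewrite !funeposE.
  by apply: H => //; exact: measurable_funepos.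
- transitivity (\int[m]_x f^\- (phi x))%E; first by apply: eq_integral => x _; rewrite !funenegE.
  by apply: H => //; exact: measurable_funeneg.
Qed.

Lemma preserving_Rintegral phi f : preserving phi -> measurable_fun setT f ->
  Rintegral m setT (fun x => f (phi x)) = Rintegral m setT f.
Proof.
move=> pphi mf; rewrite /Rintegral.
by rewrite (preserving_integral (f := EFin \o f) pphi)//; exact/measurable_EFinP.
Qed.

Lemma preserving_integrable phi f : preserving phi ->
  m.-integrable setT (EFin \o f) -> m.-integrable setT (EFin \o (fun x => f (phi x))).
Proof.
move=> pphi intf; have /integrableP[mf foo] := intf; apply/integrableP; split.
  by apply: (measurableT_comp mf); case: pphi.
rewrite (preserving_integral (f := fun x => `|(EFin \o f) x|%E) pphi)//.
exact: measurableT_comp.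
Qed.

Lemma preserving_measure phi : measurable_fun setT phi ->
  (forall A, measurable A -> m (phi @^-1` A) = m A) -> preserving phi.
Proof.
move=> mphi H; split => // f mf f0.
pose phiM : {mfun T >-> T} := HB.pack phi (isMeasurableFun.Build _ _ _ _ phi mphi).
transitivity (\int[pushforward m phiM]_x f x)%E.
  by rewrite (ge0_integral_pushforward (phi := phiM)).
by apply: eq_measure_integral => A mA _; exact: H.
Qed.
End integration.

(** * Measure-preserving maps and slices on the product space *)

Section double_integrals.
Context d (T : measurableType d) (R : realType).
Variable m : {sigma_finite_measure set T -> \bar R}.
Implicit Types F : T * T -> R.
Local Notation pi := (m \x m)%E.

Lemma swap_preserving : preserving pi (fun p => (p.2, p.1)).
Proof.
split; first by apply: measurable_fun_pair; [exact: measurable_snd|exact: measurable_fst].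
move=> f mf f0.
rewrite fubini_tonelli1//; last first.
  by apply: (measurableT_comp mf); apply: measurable_fun_pair; [exact: measurable_snd|exact: measurable_fst].
by rewrite fubini_tonelli2.
Qed.

(** Tonelli with the second variable innermost: for each fixed x the inner integral is already
    invariant. Shears and reflections of the jump variable are instances. *)
Lemma fiber_preserving (phi : T -> T -> T) :
  measurable_fun setT (fun p : T * T => phi p.1 p.2) ->
  (forall x, preserving m (phi x)) -> preserving pi (fun p => (p.1, phi p.1 p.2)).
Proof.
move=> mphi H.
have mp : measurable_fun setT (fun p : T * T => (p.1, phi p.1 p.2)).
  by apply: measurable_fun_pair => //; exact: measurable_fst.
split => // f mf f0; rewrite fubini_tonelli1//; last exact: (measurableT_comp mf).
rewrite fubini_tonelli1//; apply: eq_integral => x _ /=.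
have [mx Hx] := H x; apply: (Hx (fun y => f (x, y))) => //.
by apply: (measurableT_comp mf); exact: measurable_pair1.
Qed.

(** Integrability of the slices is not assumed: the positive and negative parts are measurable by
    Tonelli, and [fine] is a measurable map that sends infinite values to 0. *)
Lemma measurable_Rintegral F : measurable_fun setT F ->
  measurable_fun setT (fun x => Rintegral m setT (fun y => F (x, y))).
Proof.
move=> mF; apply: (measurableT_comp (f := fine)) => //.
have mE : measurable_fun setT (EFin \o F) by exact/measurable_EFinP.
have -> : (fun x => (\int[m]_y (F (x, y))%:E)%E) =
   (fun x => (\int[m]_y ((EFin \o F)^\+ (x, y)) - \int[m]_y ((EFin \o F)^\- (x, y)))%E).
  apply/funext => x; rewrite [LHS]integralE.
  by congr (_ - _)%E; apply: eq_integral => y _; rewrite ?funeposE ?funenegE.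
apply: emeasurable_funB.
- by apply: measurable_fun_fubini_tonelli_F => //; exact: measurable_funepos.
- by apply: measurable_fun_fubini_tonelli_F => //; exact: measurable_funeneg.
Qed.

Lemma Rintegral_fubini F : pi.-integrable setT (EFin \o F) ->
  fine (\int[m]_x \int[m]_y (F (x, y))%:E)%E = Rintegral pi setT F.
Proof. by move=> iF; rewrite /Rintegral -integral12_prod_meas1. Qed.

(* Where [c x = 0] the slice of [G] need not be integrable, but then both sides vanish. *)
Lemma Rintegral_slices (c : T -> R) (G : T * T -> R) :
  measurable_fun setT c -> measurable_fun setT G ->
  pi.-integrable setT (EFin \o (fun p => c p.1 * G p)) ->
  m.-integrable setT (EFin \o (fun x => c x * Rintegral m setT (fun z => G (x, z)))) /\
  Rintegral m setT (fun x => c x * Rintegral m setT (fun z => G (x, z))) =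
    Rintegral pi setT (fun p => c p.1 * G p).
Proof.
move=> mc mG iG.
have mR : measurable_fun setT (EFin \o (fun x => c x * Rintegral m setT (fun z => G (x, z)))).
  by apply/measurable_EFinP; apply: measurable_funM => //; exact: measurable_Rintegral.
have ae : ae_eq m setT (fun x => (\int[m]_z (c x * G (x, z))%:E)%E)
   (EFin \o (fun x => c x * Rintegral m setT (fun z => G (x, z)))).
  have := ae_integrable1 iG; apply: filterS => x /= ix _.
  rewrite Rintegral_EFin//; congr EFin.
  have [c0|c0] := eqVneq (c x) 0.
    rewrite c0 mul0r /Rintegral; under eq_integral do rewrite mul0r.
    by rewrite integral0.
  rewrite RintegralZl//.
  have := integrableZl measurableT (c x)^-1 ix.
  by apply: eq_integrable => // z _ /=; rewrite -EFinM mulKf.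
have iF := integrable_fubini_F iG.
have mF := measurable_int _ iF.
split.
  apply/integrableP; split => //.
  have /integrableP[_] := iF; rewrite (@ae_eq_integral _ _ _ m setT
    (fun x => `|(c x * Rintegral m setT (fun z => G (x, z)))%:E|)%E)//.
  - exact: measurableT_comp.
  - exact: measurableT_comp.
  - by move: ae; apply: filterS => x /= h /h hx; exact: (congr1 abse hx).
rewrite -Rintegral_fubini// /Rintegral; congr fine; apply: ae_eq_integral => //.
by move: ae; apply: filterS => x /= h /h hx; exact/esym.
Qed.
End double_integrals.

Lemma enorm_ball_measurable (R : realType) (n : nat) (r : R) :
  measurable [set x : 'rV[R]_n | enorm x <= r].
Proof.
rewrite -[X in measurable X]setTI.
have -> : [set x : 'rV[R]_n | enorm x <= r] = @enorm R n @^-1` `]-oo, r].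
  by apply/seteqP; split => x /=; rewrite in_itv.
by apply: measurable_fun_enorm.
Qed.

Section lebesgue_preserving.
Context (R : realType) (n : nat).
Local Notation V := 'rV[R]_n.
Variable mu : {sigma_finite_measure set V -> \bar R}.
Hypothesis Hmu : is_lebesgue mu.

Lemma shift_preserving (x : V) : preserving mu (fun z => x + z).
Proof.
apply: preserving_measure; last exact: is_lebesgue_shift.
by apply: measurable_fun_addV; [exact: measurable_cst|exact: measurable_id].
Qed.

Lemma opp_preserving : preserving mu (fun z : V => - z).
Proof.
apply: preserving_measure; last exact: is_lebesgue_opp.
by apply: measurable_fun_oppV; exact: measurable_id.
Qed.

Lemma shear_preserving : preserving (mu \x mu)%E (fun p : V * V => (p.1, p.1 + p.2)).
Proof.
apply: (@fiber_preserving _ _ _ mu (fun x z => x + z)).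
  by apply: measurable_fun_addV; [exact: measurable_fst|exact: measurable_snd].
exact: shift_preserving.
Qed.

Lemma reflect_preserving : preserving (mu \x mu)%E (fun p : V * V => (p.1, - p.2)).
Proof.
apply: (@fiber_preserving _ _ _ mu (fun _ z => - z)).
  by apply: measurable_fun_oppV; exact: measurable_snd.
by move=> x; exact: opp_preserving.
Qed.

Lemma bounded_finite_measure (r : R) : (mu [set x : V | (enorm x <= r)%R] < +oo)%E.
Proof.
apply: (@le_lt_trans _ _ (mu (@cube R n (Num.bound `|r|)))); last exact: is_lebesgue_cube.
apply: le_measure; rewrite ?inE.
- exact: enorm_ball_measurable.
- exact: closed_box_measurable.
- move=> x /= xr i; rewrite !mxE -ler_norml (le_trans (coord_le_enorm _ _))//.
  rewrite (le_trans xr)// (le_trans (ler_norm _))//.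
  by apply/ltW/archi_boundP.
Qed.
End lebesgue_preserving.

(** Product measures and Tonelli ask for the sigma-finite structure, while the theorem quantifies
    over plain measures. Destructing [mu] first lets the new structure coerce back to it by
    conversion. *)
Lemma sigma_finite_pack (R : realType) (n : nat) (mu : {measure set 'rV[R]_n -> \bar R}) :
  is_lebesgue mu -> exists m : {sigma_finite_measure set 'rV[R]_n -> \bar R},
    (m : {measure set 'rV[R]_n -> \bar R}) = mu.
Proof.
case: mu => f [c1 c2] Hmu; pose mu := Measure.Pack (Measure.Class c2).
have s1 := @is_lebesgue_sigma_finite R n mu Hmu.
pose f2 := isSigmaFinite.Build _ _ _ (Measure.sort mu) s1.
pose f1 := isSFinite.Build _ _ _ (Measure.sort mu) (sfinite_measure_sigma_finite s1).
pose m : {sigma_finite_measure set 'rV[R]_n -> \bar R} := HB.pack (Measure.sort mu) f1 f2.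
exists m.
reflexivity.
Qed.

Section more_integration.
Context d (T : measurableType d) (R : realType).
Variable m : {measure set T -> \bar R}.
Implicit Types f g sigma alpha : T -> R.

Lemma measurable_fun_sqrt f : measurable_fun setT f ->
  measurable_fun setT (fun x => Num.sqrt (f x)).
Proof.
move=> mf; apply: (measurableT_comp (f := @Num.sqrt R)) => //.
by apply: continuous_measurable_fun; exact: sqrt_continuous.
Qed.

(** On nonnegative reals inversion is the power with exponent -1, and the two conventions agree at
    0. *)
Lemma measurable_fun_inv_ge0 f : (forall x, 0 <= f x) -> measurable_fun setT f ->
  measurable_fun setT (fun x => (f x)^-1).
Proof.
move=> f0 mf.
have -> : (fun x => (f x)^-1) = (fun x => f x `^ (-1)).
  by apply/funext => x; rewrite powR_inv1.
by apply: (measurableT_comp (f := fun y => y `^ (-1))) => //; exact: measurable_powR.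
Qed.

(* Cauchy-Schwarz for [f sqrt(sigma)] and [g alpha / sqrt(sigma)]; the bound on
   [alpha] makes the junk value [alpha / sqrt 0 = 0] harmless. *)
Lemma weighted_cauchy_schwarz f g sigma alpha :
  measurable_fun setT f -> measurable_fun setT g ->
  measurable_fun setT sigma -> measurable_fun setT alpha ->
  (forall x, `|alpha x| <= sigma x) ->
  m.-integrable setT (EFin \o (fun x => f x ^+ 2 * sigma x)) ->
  m.-integrable setT (EFin \o (fun x => g x ^+ 2 * (alpha x ^+ 2 / sigma x))) ->
  m.-integrable setT (EFin \o (fun x => f x * g x * alpha x)) /\
  (Rintegral m setT (fun x => f x * g x * alpha x)) ^+ 2 <=
    Rintegral m setT (fun x => f x ^+ 2 * sigma x) *
    Rintegral m setT (fun x => g x ^+ 2 * (alpha x ^+ 2 / sigma x)).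
Proof.
move=> mf mg ms ma as_.
have s0 x : 0 <= sigma x by exact: le_trans (as_ x).
have E1 : (fun x => f x ^+ 2 * sigma x) = (fun x => (f x * Num.sqrt (sigma x)) ^+ 2).
  by apply/funext => x; rewrite exprMn sqr_sqrtr.
have E2 : (fun x => g x ^+ 2 * (alpha x ^+ 2 / sigma x)) =
    (fun x => (g x * (alpha x / Num.sqrt (sigma x))) ^+ 2).
  by apply/funext => x; rewrite !exprMn exprVn sqr_sqrtr.
have E3 : (fun x => f x * g x * alpha x) =
    (fun x => (f x * Num.sqrt (sigma x)) * (g x * (alpha x / Num.sqrt (sigma x)))).
  apply/funext => x; have [s00|s00] := eqVneq (sigma x) 0.
    have := as_ x; rewrite s00 normr_le0 => /eqP ->.
    by rewrite mul0r !mulr0.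
  field; rewrite sqrtr_eq0 -ltNge lt_neqAle eq_sym s00 s0//.
rewrite E1 E2 E3; apply: cauchy_schwarz.
  by apply: measurable_funM => //; exact: measurable_fun_sqrt.
apply: measurable_funM => //; apply: measurable_funM => //.
by apply: measurable_fun_inv_ge0 => [x|]; [exact: sqrtr_ge0|exact: measurable_fun_sqrt].
Qed.

Lemma Rintegral_sum (I : Type) (r : seq I) (F : I -> T -> R) :
  (forall i, m.-integrable setT (EFin \o F i)) ->
  m.-integrable setT (EFin \o (fun x => \sum_(i <- r) F i x)) /\
  Rintegral m setT (fun x => \sum_(i <- r) F i x) = \sum_(i <- r) Rintegral m setT (F i).
Proof.
move=> iF; elim: r => [|i r [IH1 IH2]].
  have -> : (fun x : T => \sum_(i <- [::]) F i x) = cst 0.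
    by apply/funext => x; rewrite big_nil.
  by split; [exact: integrable0|rewrite big_nil /Rintegral integral0].
have -> : (fun x : T => \sum_(j <- i :: r) F j x) =
    (fun x => F i x + \sum_(j <- r) F j x).
  by apply/funext => x; rewrite big_cons.
split; first exact: (integrableD measurableT (iF i) IH1).
by rewrite RintegralD// IH2 big_cons.
Qed.

Lemma integrableZ_EFin (c : R) f : m.-integrable setT (EFin \o f) ->
  m.-integrable setT (EFin \o (fun x => c * f x)).
Proof. by move=> /(integrableZl measurableT c). Qed.

Lemma integrableD_EFin f g : m.-integrable setT (EFin \o f) ->
  m.-integrable setT (EFin \o g) -> m.-integrable setT (EFin \o (fun x => f x + g x)).
Proof. by move=> mf mg; exact: (integrableD measurableT mf mg). Qed.

Lemma preserving_comp phi psi : preserving m phi -> preserving m psi ->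
  preserving m (fun x => psi (phi x)).
Proof.
move=> [mphi Hphi] [mpsi Hpsi]; split; first exact: (measurableT_comp mpsi).
move=> f mf f0; rewrite (Hphi (fun x => f (psi x)))// ?Hpsi//.
exact: (measurableT_comp mf).
Qed.
End more_integration.

Section local_integrability.
Context (R : realType) (n : nat).
Local Notation V := 'rV[R]_n.
Variable mu : {sigma_finite_measure set V -> \bar R}.
Hypothesis Hmu : is_lebesgue mu.

Definition ball_indic (r : R) (x : V) : R := if enorm x <= r then 1 else 0.

Lemma ball_indic_ge0 r x : 0 <= ball_indic r x.
Proof. by rewrite /ball_indic; case: ifP. Qed.

Lemma measurable_ball_indic r : measurable_fun setT (ball_indic r).
Proof.
apply: measurable_fun_ifT => //.
by apply: measurable_fun_ler => //; apply: measurable_fun_enorm.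
Qed.

Lemma ball_indic_integral r (h : V -> \bar R) :
  (\int[mu]_x ((ball_indic r x)%:E * h x) = \int[mu]_(x in [set x | (enorm x <= r)%R]) h x)%E.
Proof.
rewrite [RHS]integral_mkcond; apply: eq_integral => x _.
rewrite patchE /ball_indic; have [xr|xr] := boolP (enorm x <= r).
  by rewrite mem_set// mul1e.
by rewrite memNset ?mul0e//; exact/negP.
Qed.

(** On a set of finite measure L^2 is contained in L^1, by t <= 1 + t^2. This turns the hypotheses
    on slice integrals into integrability on the product, localised in the first variable. *)
Lemma locally_square_integrable (G : V * V -> R) r :
  measurable_fun setT G -> (forall p, 0 <= G p) ->
  (\int[mu]_(x in [set x | (enorm x <= r)%R])
     ((\int[mu]_y (G (x, y))%:E) * (\int[mu]_y (G (x, y))%:E)) < +oo)%E ->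
  (mu \x mu)%E.-integrable setT (EFin \o (fun p => ball_indic r p.1 * G p)).
Proof.
move=> mG G0 Goo.
have mB := measurable_ball_indic.
have mBG : measurable_fun setT (fun p : V * V => ball_indic r p.1 * G p).
  by apply: measurable_funM => //; apply: (measurableT_comp (mB r)); exact: measurable_fst.
have BG0 p : 0 <= ball_indic r p.1 * G p by rewrite mulr_ge0// ball_indic_ge0.
apply: integrable_ge0_lty => //.
have mGE : measurable_fun setT (EFin \o G) by exact/measurable_EFinP.
have mGx (x : V) : measurable_fun setT (fun y => (G (x, y))%:E).
  exact: (measurableT_comp mGE (pair1_measurable x)).
have mg : measurable_fun setT (fun x => \int[mu]_y (G (x, y))%:E)%E.
  by apply: (@measurable_fun_fubini_tonelli_F _ _ _ _ _ _ (EFin \o G)) => // p; rewrite lee_fin.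
have g0 x : (0 <= \int[mu]_y (G (x, y))%:E)%E by apply: integral_ge0 => y _; rewrite lee_fin.
rewrite (fubini_tonelli1 (EFin \o (fun p => ball_indic r p.1 * G p)))//; last first.
  exact/measurable_EFinP.
have E x : fubini_F mu (EFin \o (fun p => ball_indic r p.1 * G p)) x =
    ((ball_indic r x)%:E * \int[mu]_y (G (x, y))%:E)%E.
  transitivity (\int[mu]_y ((ball_indic r x)%:E * (G (x, y))%:E))%E.
    by apply: eq_integral => y _; rewrite /= EFinM.
  apply: (@ge0_integralZl _ _ _ mu setT measurableT (fun y => (G (x, y))%:E) (mGx x)).
  - by move=> y _; rewrite lee_fin.
  - by rewrite lee_fin ball_indic_ge0.
under eq_integral do rewrite E.
rewrite ball_indic_integral.
set B := [set x | _].
have mBm : measurable B by exact: enorm_ball_measurable.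
apply: (@le_lt_trans _ _ (\int[mu]_(x in B) (1%:E +
  (\int[mu]_y (G (x, y))%:E) * (\int[mu]_y (G (x, y))%:E)))%E).
  apply: ge0_le_integral => //.
  - exact: measurable_funTS.
  - apply: measurable_funTS; apply: emeasurable_funD => //.
    exact: emeasurable_funM.
  - move=> x _; move: (\int[mu]_y (G (x, y))%:E)%E (g0 x) => [g| |]//= g00.
    by rewrite -EFinM -EFinD !lee_fin; rewrite lee_fin in g00; nra.
rewrite ge0_integralD//.
- rewrite lte_add_pinfty// integral_cst// mul1e.
  exact: bounded_finite_measure.
- by move=> x _; rewrite mule_ge0.
- by apply: measurable_funTS; exact: emeasurable_funM.
Qed.
End local_integrability.

(** * The symmetric part of the form *)

Lemma Cc_lip_bounds (R : realType) (n : nat) (v : 'rV[R]_n -> R) : Cc_lip v ->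
  exists r C, [/\ 0 <= C, forall x, r < enorm x -> v x = 0, forall x, `|v x| <= C &
    forall x z, `|v (x + z) - v x| <= C * enorm z].
Proof.
move=> hv; have cv := Cc_lip_continuous hv; have [[r vr] [C vC]] := hv.
have [B vB] := compact_support_bounded (ex_intro _ r vr) cv.
have [B0 C0] := (normr_ge0 B, normr_ge0 C).
exists r, (`|B| + `|C|); split => //.
  by move=> x; rewrite (le_trans (vB x))// (le_trans (ler_norm _))// lerDl.
move=> x z; have := vC (x + z) x; rewrite [x + z]addrC addrK => h.
apply: le_trans h _; rewrite ler_wpM2r ?enorm_ge0//.
by rewrite (le_trans (ler_norm C))// lerDr.
Qed.

Lemma Cc_lip_measurable (R : realType) (n : nat) (v : 'rV[R]_n -> R) :
  Cc_lip v -> measurable_fun setT v.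
Proof. by move=> /Cc_lip_continuous; exact: continuous_measurable_rV. Qed.

Definition unit_indic (R : realType) (n : nat) (z : 'rV[R]_n) : R :=
  if enorm z <= 1 then 1 else 0.

Definition cutoff (R : realType) (n : nat) (k : nat) (z : 'rV[R]_n) : R :=
  if k.+1%:R^-1 < enorm z then 1 else 0.

Lemma measurable_if_le d (T : measurableType d) (R : realType) (f g : T -> R) :
  measurable_fun setT f -> measurable_fun setT g ->
  measurable_fun setT (fun t => if f t <= g t then 1 else 0 : R).
Proof. by move=> mf mg; apply: measurable_fun_ifT => //; exact: measurable_fun_ler. Qed.

Lemma measurable_if_lt d (T : measurableType d) (R : realType) (f g : T -> R) :
  measurable_fun setT f -> measurable_fun setT g ->
  measurable_fun setT (fun t => if f t < g t then 1 else 0 : R).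
Proof. by move=> mf mg; apply: measurable_fun_ifT => //; exact: measurable_fun_ltr. Qed.

Lemma measurable_fun_min d (T : measurableType d) (R : realType) (f g : T -> R) :
  measurable_fun setT f -> measurable_fun setT g ->
  measurable_fun setT (fun t => Num.min (f t) (g t)).
Proof. by move=> mf mg; exact: measurable_minr. Qed.

Lemma measurable_comp2 d (T : measurableType d) (R : realType) (n : nat)
    (s : 'rV[R]_n -> 'rV[R]_n -> R) (f g : T -> 'rV[R]_n) :
  measurable_fun setT (fun p : 'rV[R]_n * 'rV[R]_n => s p.1 p.2) ->
  measurable_fun setT f -> measurable_fun setT g ->
  measurable_fun setT (fun t => s (f t) (g t)).
Proof.
move=> ms mf mg; exact: (measurableT_comp ms (measurable_fun_pair mf mg)).
Qed.

Lemma measurable_section (R : realType) (n : nat) (s : 'rV[R]_n -> 'rV[R]_n -> R) x :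
  measurable_fun setT (fun p : 'rV[R]_n * 'rV[R]_n => s p.1 p.2) ->
  measurable_fun setT (s x).
Proof. by move=> ms; exact: (measurableT_comp ms (pair1_measurable x)). Qed.

Lemma measurable_fun_normr d (T : measurableType d) (R : realType) (f : T -> R) :
  measurable_fun setT f -> measurable_fun setT (fun t => `|f t|).
Proof. by move=> mf; apply: (@measurableT_comp _ _ _ _ _ _ (@Num.norm R R)). Qed.

(** Structural search for measurability. Kernels and functions are recognised by their hypotheses in
    the context, a kernel either at two measurable arguments or with its first argument fixed. *)
Ltac meas := repeat first
  [ assumption | exact: measurable_cst | exact: measurable_id
  | exact: measurable_fst | exact: measurable_snd
  | apply: measurable_fun_addV | apply: measurable_fun_oppV
  | apply: measurable_fun_enorm | apply: measurable_fun_coord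
  | apply: measurable_if_le | apply: measurable_if_lt
  | apply: measurable_fun_min | apply: measurable_fun_normr
  | match goal with H : measurable_fun setT (fun p => ?s p.1 p.2) |-
      measurable_fun _ (fun t => ?s _ _) => apply: (measurable_comp2 H) end
  | match goal with H : measurable_fun setT (fun p => ?s p.1 p.2) |-
      measurable_fun _ (?s ?x) =>
      exact: (measurable_section x H) end
  | match goal with H : measurable_fun setT ?u |-
      measurable_fun _ (fun t => ?u _) => apply: (measurableT_comp H) end
  | apply: measurable_funX | apply: measurable_funM
  | apply: measurable_funB | apply: measurable_funD | apply: measurable_sum => ? ].

Section symmetric_kernel.
Context (R : realType) (n : nat).
Local Notation V := 'rV[R]_n.
Variable mu : {sigma_finite_measure set V -> \bar R}.
Hypothesis Hmu : is_lebesgue mu.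
Variable s : V -> V -> R.
Hypothesis ms : measurable_fun setT (fun p : V * V => s p.1 p.2).
Hypothesis s_ge0 : forall x y, 0 <= s x y.
Hypothesis s_sym : forall x y, s x y = s y x.
Local Notation pi := (mu \x mu)%E.
Hypothesis levy_int : forall r, pi.-integrable setT (EFin \o (fun p : V * V =>
  ball_indic r p.1 * (Num.min 1 (enorm (p.2 - p.1) ^+ 2) * s p.1 p.2))).

Definition energy (u : V -> R) (p : V * V) : R := (u p.1 - u p.2) ^+ 2 * s p.1 p.2.

(** The squared increment is at most 4 C^2 min(1, |y-x|^2) and vanishes unless x or y lies in the
    support ball. [levy_int] covers the first case; its image under the swap covers the second,
    because s is symmetric. *)
Lemma energy_integrable u : Cc_lip u -> pi.-integrable setT (EFin \o energy u).
Proof.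
move=> hu; have mu_ := Cc_lip_measurable hu.
have [r [C [C0 ur uC uL]]] := Cc_lip_bounds hu.
have i1 := levy_int r.
have i2 := preserving_integrable (swap_preserving mu) i1.
apply: (integrable_le _ _ (integrableZ_EFin (4 * C ^+ 2) (integrableD_EFin i1 i2))).
  by rewrite /energy; meas.
move=> [x y] /=; rewrite /energy /= (ger0_norm (mulr_ge0 (sqr_ge0 _) (s_ge0 _ _))).
have uxy : (u x - u y) ^+ 2 <= 4 * C ^+ 2 * Num.min 1 (enorm (y - x) ^+ 2).
  have h1 := uL x (y - x); rewrite [x + _]addrC subrK in h1.
  have h2 : `|u y - u x| <= 2 * C.
    by apply: le_trans (ler_normB _ _) _; have := uC x; have := uC y; lra.
  rewrite -sqrrN opprB -(real_normK (num_real (u y - u x))).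
  have e0 := enorm_ge0 (y - x); have n0 := normr_ge0 (u y - u x).
  by rewrite /Num.min; case: ifP => _; nra.
rewrite -[x - y]opprB enormN (s_sym y x).
set m := Num.min _ _ in uxy *.
have m0 : 0 <= m by rewrite le_min ler01 sqr_ge0.
have ms0 : 0 <= m * s x y by rewrite mulr_ge0.
have [xr|xr] := leP (enorm x) r.
  rewrite {1}/ball_indic xr mul1r.
  have b0 : 0 <= ball_indic r y * (m * s x y) by rewrite mulr_ge0// ball_indic_ge0.
  have := ler_wpM2r (s_ge0 x y) uxy; nra.
have [yr|yr] := leP (enorm y) r.
  rewrite /ball_indic yr [enorm x <= r]leNgt xr mul1r mul0r add0r mulrA.
  exact: ler_wpM2r.
rewrite ur// ur// subrr expr0n /= mul0r.
have bx := mulr_ge0 (ball_indic_ge0 r x) ms0.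
have b_y := mulr_ge0 (ball_indic_ge0 r y) ms0.
by have := sqr_ge0 C; nra.
Qed.

Lemma levy_shear r : pi.-integrable setT (EFin \o (fun p : V * V =>
  ball_indic r p.1 * (Num.min 1 (enorm p.2 ^+ 2) * s p.1 (p.1 + p.2)))).
Proof.
have := preserving_integrable (shear_preserving Hmu) (levy_int r).
apply: eq_integrable => // -[x z] _ /=.
by rewrite [x + z]addrC addrK.
Qed.

(** This is [weighted_cauchy_schwarz] with both weights equal to s, since s^2 / s = s even where s =
    0. *)
Lemma energy_cross u v : measurable_fun setT u -> measurable_fun setT v ->
  pi.-integrable setT (EFin \o energy u) -> pi.-integrable setT (EFin \o energy v) ->
  pi.-integrable setT (EFin \o
    (fun p : V * V => (u p.1 - u p.2) * (v p.1 - v p.2) * s p.1 p.2)) /\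
  (Rintegral pi setT (fun p => (u p.1 - u p.2) * (v p.1 - v p.2) * s p.1 p.2)) ^+ 2 <=
    Rintegral pi setT (energy u) * Rintegral pi setT (energy v).
Proof.
move=> mu_ mv iu iv.
have E : (fun p : V * V => (v p.1 - v p.2) ^+ 2 * (s p.1 p.2 ^+ 2 / s p.1 p.2)) = energy v.
  apply/funext => p; rewrite /energy.
  have [->|s0] := eqVneq (s p.1 p.2) 0; first by rewrite expr0n /= mul0r mulr0.
  by rewrite expr2 mulfK.
have := @weighted_cauchy_schwarz _ _ _ pi (fun p => u p.1 - u p.2)
  (fun p => v p.1 - v p.2) (fun p => s p.1 p.2) (fun p => s p.1 p.2).
rewrite E; apply => //; try by meas.
by move=> p; rewrite ger0_norm.
Qed.

Section smooth_function.
Variable u : V -> R.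
Hypothesis hu : C2c u.
Definition taylor_rest (x z : V) : R :=
  u (x + z) - u x - grad_dot u x z * unit_indic z.

Lemma C2c_measurable : measurable_fun setT u.
Proof. by case: hu => _ [cu _]; exact: continuous_measurable_rV. Qed.

Lemma partial_measurable i : measurable_fun setT (partial i u).
Proof. by case: hu => _ [_ [_ [cu _]]]; exact: continuous_measurable_rV. Qed.

Lemma measurable_grad_dot d (T : measurableType d) (f g : T -> V) :
  measurable_fun setT f -> measurable_fun setT g ->
  measurable_fun setT (fun t => grad_dot u (f t) (g t)).
Proof.
move=> mf mg; rewrite /grad_dot; apply: measurable_sum => i.
by have mp := partial_measurable i; meas.
Qed.

Lemma measurable_unit_indic d (T : measurableType d) (f : T -> V) :
  measurable_fun setT f -> measurable_fun setT (fun t => unit_indic (f t)).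
Proof. by move=> mf; rewrite /unit_indic; meas. Qed.

Lemma measurable_cutoff d (T : measurableType d) k (f : T -> V) :
  measurable_fun setT f -> measurable_fun setT (fun t => cutoff k (f t)).
Proof. by move=> mf; rewrite /cutoff; meas. Qed.

Lemma measurable_taylor_rest d (T : measurableType d) (f g : T -> V) :
  measurable_fun setT f -> measurable_fun setT g ->
  measurable_fun setT (fun t => taylor_rest (f t) (g t)).
Proof.
move=> mf mg; have mu_ := C2c_measurable; rewrite /taylor_rest.
apply: measurable_funB; first by meas.
by apply: measurable_funM; [exact: measurable_grad_dot|exact: measurable_unit_indic].
Qed.
End smooth_function.
End symmetric_kernel.

Section pointwise_bounds.
Context (R : realType) (n : nat).
Local Notation V := 'rV[R]_n.
Implicit Types u : V -> R.

Lemma grad_dot_bound u : C2c u ->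
  exists K, 0 <= K /\ forall x z, `|grad_dot u x z| <= K * enorm z.
Proof.
move=> /C2c_bounds[r [C [C0 _ _ _ [pC _ _]]]].
exists (C * n%:R); split; first by rewrite mulr_ge0.
move=> x z; apply: le_trans (ler_norm_sum _ _ _) _.
apply: (@le_trans _ _ (C * \sum_(i < n) `|z ord0 i|)).
  by rewrite mulr_sumr ler_sum// => i _; rewrite normrM ler_wpM2r.
by rewrite -mulrA ler_wpM2l// sum_coord_le.
Qed.

Lemma taylor_rest_bound u : C2c u ->
  exists K, 0 <= K /\ forall x z, `|taylor_rest u x z| <= K * Num.min 1 (enorm z ^+ 2).
Proof.
move=> /C2c_bounds[r [C [C0 _ _ uC [_ _ tC]]]].
exists (2 * C); split; first by rewrite mulr_ge0.
move=> x z; rewrite /taylor_rest /unit_indic; have e0 := enorm_ge0 z.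
have [z1|z1] := leP (enorm z) 1.
  rewrite mulr1 min_r; last by nra.
  by apply: le_trans (tC x z) _; have := sqr_ge0 (enorm z); nra.
rewrite mulr0 subr0 min_l; last by nra.
apply: le_trans (ler_normB _ _) _.
by have := uC x; have := uC (x + z); lra.
Qed.

Lemma cutoff_ge0 k (z : V) : 0 <= cutoff k z.
Proof. by rewrite /cutoff; case: ifP. Qed.

Lemma cutoff_le1 k (z : V) : cutoff k z <= 1.
Proof. by rewrite /cutoff; case: ifP. Qed.

Lemma cutoffN k (z : V) : cutoff k (- z) = cutoff k z.
Proof. by rewrite /cutoff enormN. Qed.

Lemma unit_indicN (z : V) : unit_indic (- z) = unit_indic z.
Proof. by rewrite /unit_indic enormN. Qed.

Lemma unit_indic_ge0 (z : V) : 0 <= unit_indic z.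
Proof. by rewrite /unit_indic; case: ifP. Qed.

(** Where the cutoff is 1, (k+1)|z| > 1. Hence any bounded integrand, once truncated, is dominated
    by the weight min(1, |z|^2), with a constant depending on k. *)
Lemma cutoff_le k (z : V) : cutoff k z <= k.+1%:R ^+ 2 * Num.min 1 (enorm z ^+ 2).
Proof.
have m0 : 0 <= Num.min 1 (enorm z ^+ 2) by rewrite le_min ler01 sqr_ge0.
rewrite /cutoff; case: ifP => h; last by rewrite mulr_ge0// sqr_ge0.
have k1 : (1 : R) <= k.+1%:R by rewrite ler1n.
rewrite minr_pMr ?sqr_ge0// mulr1 le_min -exprMn; apply/andP; split; first by nra.
have : 1 < k.+1%:R * enorm z by rewrite -ltr_pdivrMl ?mulr1// ltr0n.
by nra.
Qed.

Lemma cutoff_cvg (z : V) : z != 0 -> cutoff k z @[k --> \oo] --> (1 : R).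
Proof.
move=> z0; have ez : 0 < enorm z by rewrite lt_neqAle enorm_ge0 eq_sym enorm_eq0 z0.
apply: cvg_near_cst; have := near_infty_natSinv_lt (PosNum ez).
by apply: filterS => k /= h; rewrite /cutoff h.
Qed.

Lemma grad_dotN u (x z : V) : grad_dot u x (- z) = - grad_dot u x z.
Proof. by rewrite /grad_dot -sumrN; apply: eq_bigr => i _; rewrite mxE mulrN. Qed.

Lemma grad_dot0 u (x : V) : grad_dot u x 0 = 0.
Proof. by rewrite /grad_dot big1// => i _; rewrite mxE mulr0. Qed.
End pointwise_bounds.

(** * The truncation argument for the symmetric part *)

Section symmetric_identity.
Context (R : realType) (n : nat).
Local Notation V := 'rV[R]_n.
Variable mu : {sigma_finite_measure set V -> \bar R}.
Hypothesis Hmu : is_lebesgue mu.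
Variable s : V -> V -> R.
Hypothesis ms : measurable_fun setT (fun p : V * V => s p.1 p.2).
Hypothesis s_ge0 : forall x y, 0 <= s x y.
Hypothesis s_sym : forall x y, s x y = s y x.
Hypothesis s_diag : forall x, s x x = 0.
Local Notation pi := (mu \x mu)%E.
Hypothesis levy_int : forall r, pi.-integrable setT (EFin \o (fun p : V * V =>
  ball_indic r p.1 * (Num.min 1 (enorm (p.2 - p.1) ^+ 2) * s p.1 p.2))).
Hypothesis jump_int : forall r, pi.-integrable setT (EFin \o (fun p : V * V =>
  ball_indic r p.1 * (unit_indic p.2 * (enorm p.2 *
    `|s p.1 (p.1 + p.2) - s p.1 (p.1 - p.2)|)))).

(** In the coordinates (x, x + z) this map is the swap, so it is the composition of a shear, the
    swap and the inverse shear. *)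
Lemma flip_preserving : preserving pi (fun p : V * V => (p.1 + p.2, - p.2)).
Proof.
have h : preserving pi (fun p : V * V => (p.1, - p.1 + p.2)).
  apply: (@fiber_preserving _ _ _ mu (fun x z => - x + z)); first by meas.
  by move=> x; exact: shift_preserving.
have := preserving_comp (preserving_comp (shear_preserving Hmu) (swap_preserving mu)) h.
congr preserving; apply/funext => -[x z] /=.
by rewrite opprD addrAC addNr add0r.
Qed.

Variables u v : V -> R.
Hypothesis hu : C2c u.
Hypothesis hv : Cc_lip v.

(** [T1] is the energy integrand, [T2] and [T3] are the compensated and drift integrands tested
    against v. [F] weights them as in the claim (1/2) E(u,v) + <Lu,v> = 0 for the symmetric part. *)
Let T1 (p : V * V) := (u p.1 - u (p.1 + p.2)) * (v p.1 - v (p.1 + p.2)) * s p.1 (p.1 + p.2).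
Let T2 (p : V * V) := v p.1 * (taylor_rest u p.1 p.2 * s p.1 (p.1 + p.2)).
Let T3 (p : V * V) := v p.1 * (grad_dot u p.1 p.2 *
  (unit_indic p.2 * (s p.1 (p.1 + p.2) - s p.1 (p.1 - p.2)))).
Let F p := T1 p / 2 + T2 p + T3 p / 2.
Let H k (p : V * V) := v p.1 * (u p.1 - u (p.1 + p.2)) * s p.1 (p.1 + p.2) * cutoff k p.2.
Let Q k (p : V * V) := v p.1 * grad_dot u p.1 p.2 * unit_indic p.2 *
  s p.1 (p.1 + p.2) * cutoff k p.2.

Let mu_ : measurable_fun setT u. Proof. exact: C2c_measurable. Qed.
Let mv : measurable_fun setT v. Proof. exact: Cc_lip_measurable. Qed.
Let mg : measurable_fun setT (fun p : V * V => grad_dot u p.1 p.2).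
Proof. by apply: measurable_grad_dot => //; meas. Qed.
Let mt : measurable_fun setT (fun p : V * V => taylor_rest u p.1 p.2).
Proof. by apply: measurable_taylor_rest => //; meas. Qed.
Let mi : measurable_fun setT (@unit_indic R n).
Proof. by apply: measurable_unit_indic; meas. Qed.
Let mc k : measurable_fun setT (@cutoff R n k).
Proof. by apply: measurable_cutoff; meas. Qed.

Let supported_bound r B (f : V -> R) x (g h : R) :
  (forall x, r < enorm x -> f x = 0) -> (forall x, `|f x| <= B) ->
  `|g| <= h -> `|f x * g| <= B * (ball_indic r x * h).
Proof.
move=> fr fB gh; have [xr|xr] := leP (enorm x) r.
  by rewrite /ball_indic xr mul1r normrM ler_pM.
by rewrite fr// mul0r normr0 /ball_indic [enorm _ <= r]leNgt xr mul0r mulr0.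
Qed.

Lemma integrable_T1 : pi.-integrable setT (EFin \o T1).
Proof.
have [i1 _] := energy_cross ms s_ge0 mu_ mv
  (energy_integrable ms s_ge0 s_sym levy_int (C2c_Cc_lip hu))
  (energy_integrable ms s_ge0 s_sym levy_int hv).
exact: (preserving_integrable (shear_preserving Hmu) i1).
Qed.

Lemma integrable_T2 : pi.-integrable setT (EFin \o T2).
Proof.
have [r [C [C0 vr vC _]]] := Cc_lip_bounds hv.
have [K [K0 tK]] := taylor_rest_bound hu.
apply: (integrable_le _ _ (integrableZ_EFin (C * K) (levy_shear Hmu levy_int r))).
  by rewrite /T2; meas.
move=> [x z]; rewrite /T2 /= -mulrA [K * _]mulrCA.
apply: (supported_bound _ vr vC).
by rewrite normrM (ger0_norm (s_ge0 _ _)) mulrA ler_wpM2r.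
Qed.

Lemma integrable_T3 : pi.-integrable setT (EFin \o T3).
Proof.
have [r [C [C0 vr vC _]]] := Cc_lip_bounds hv.
have [K [K0 gK]] := grad_dot_bound hu.
apply: (integrable_le _ _ (integrableZ_EFin (C * K) (jump_int r))).
  by rewrite /T3; meas.
move=> [x z]; rewrite /T3 /= -mulrA [K * _]mulrCA.
apply: (supported_bound _ vr vC).
rewrite normrM normrM (ger0_norm (unit_indic_ge0 z)).
rewrite [X in _ <= X](_ : _ = (K * enorm z) *
  (unit_indic z * `|s x (x + z) - s x (x - z)|)); last by ring.
by rewrite ler_wpM2r// mulr_ge0// unit_indic_ge0.
Qed.

Lemma integrable_H k : pi.-integrable setT (EFin \o H k).
Proof.
have [r [C [C0 vr vC _]]] := Cc_lip_bounds hv.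
have [_ [D [D0 _ _ uD _]]] := C2c_bounds hu.
(* 2 D bounds the increments of u, and (k+1)^2 comes from [cutoff_le]. *)
pose B := 2 * D * k.+1%:R ^+ 2.
apply: (integrable_le _ _ (integrableZ_EFin (C * B) (levy_shear Hmu levy_int r))).
  by rewrite /H; meas.
move=> [x z]; rewrite /= -[C * B * _]mulrA [B * _]mulrCA.
rewrite (_ : H k (x, z) = v x * ((u x - u (x + z)) * cutoff k z * s x (x + z)));
  last by rewrite /H /=; ring.
apply: (supported_bound _ vr vC).
rewrite 2!normrM (ger0_norm (s_ge0 _ _)) (ger0_norm (cutoff_ge0 _ _)) [B * _]mulrA.
have h1 : `|u x - u (x + z)| <= 2 * D.
  by apply: le_trans (ler_normB _ _) _; have := uD x; have := uD (x + z); lra.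
have h2 := cutoff_le k z.
have h3 : `|u x - u (x + z)| * cutoff k z <= B * Num.min 1 (enorm z ^+ 2).
  by rewrite /B -[_ * _ * _ * _]mulrA ler_pM// cutoff_ge0.
exact: ler_wpM2r.
Qed.

Lemma integrable_Q k : pi.-integrable setT (EFin \o Q k).
Proof.
have [r [C [C0 vr vC _]]] := Cc_lip_bounds hv.
have [K [K0 gK]] := grad_dot_bound hu.
pose B := K * k.+1%:R ^+ 2.
apply: (integrable_le _ _ (integrableZ_EFin (C * B) (levy_shear Hmu levy_int r))).
  by rewrite /Q; meas.
move=> [x z]; rewrite /= -[C * B * _]mulrA [B * _]mulrCA.
rewrite (_ : Q k (x, z) = v x *
  (grad_dot u x z * unit_indic z * cutoff k z * s x (x + z))); last by rewrite /Q /=; ring.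
apply: (supported_bound _ vr vC).
rewrite 3!normrM (ger0_norm (s_ge0 _ _)) (ger0_norm (cutoff_ge0 _ _)).
rewrite (ger0_norm (unit_indic_ge0 _)).
have h1 : `|grad_dot u x z| * unit_indic z <= K.
  rewrite /unit_indic; case: ifP => z1; last by rewrite mulr0.
  by rewrite mulr1; apply: le_trans (gK x z) _; rewrite ler_piMr.
have h2 := cutoff_le k z.
have h3 : `|grad_dot u x z| * unit_indic z * cutoff k z <= B * Num.min 1 (enorm z ^+ 2).
  by rewrite /B -[K * _ * _]mulrA ler_pM// ?cutoff_ge0// mulr_ge0// unit_indic_ge0.
by rewrite [X in _ <= X]mulrA; exact: ler_wpM2r.
Qed.

(* [H] and [Q], which are integrable only when truncated, enter through differences with
   their images under measure-preserving maps; hence the left-hand side has integral 0. *)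
Lemma cutoff_decomposition k (p : V * V) : F p * cutoff k p.2 =
  2^-1 * (H k (p.1 + p.2, - p.2) - H k p) + 2^-1 * (Q k (p.1, - p.2) - Q k p).
Proof.
case: p => x z; rewrite /F /T1 /T2 /T3 /H /Q /= addrK cutoffN unit_indicN grad_dotN.
by rewrite (s_sym (x + z) x) /taylor_rest; field.
Qed.

(** [F] is integrable without truncation, each of its truncations has integral 0 by
    [cutoff_decomposition], and dominated convergence with bound |F| passes this to [F] itself. *)
Lemma Rintegral_symmetric_identity :
  2^-1 * Rintegral pi setT (fun p => (u p.1 - u p.2) * (v p.1 - v p.2) * s p.1 p.2) +
  Rintegral pi setT T2 + 2^-1 * Rintegral pi setT T3 = 0.
Proof.
have iF : pi.-integrable setT (EFin \o F).
  have := integrableD_EFin (integrableD_EFin (integrableZ_EFin 2^-1 integrable_T1) integrable_T2)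
    (integrableZ_EFin 2^-1 integrable_T3).
  by apply: eq_integrable => // p _ /=; rewrite /F; congr EFin; ring.
have mF := integrable_measurable iF.
have E : Rintegral pi setT F = 2^-1 * Rintegral pi setT
    (fun p => (u p.1 - u p.2) * (v p.1 - v p.2) * s p.1 p.2) +
    Rintegral pi setT T2 + 2^-1 * Rintegral pi setT T3.
  have -> : F = (fun p => (2^-1 * T1 p + T2 p) + 2^-1 * T3 p).
    by apply/funext => p; rewrite /F; ring.
  rewrite RintegralD//; last 2 first.
  - exact: integrableD_EFin (integrableZ_EFin 2^-1 integrable_T1) integrable_T2.
  - exact: integrableZ_EFin integrable_T3.
  rewrite RintegralD//; last 2 first.
  - exact: integrableZ_EFin integrable_T1.
  - exact: integrable_T2.
  rewrite !RintegralZl//; [|exact: integrable_T3|exact: integrable_T1].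
  congr (2^-1 * _ + _ + _).
  rewrite -(preserving_Rintegral (shear_preserving Hmu)
    (f := fun p => (u p.1 - u p.2) * (v p.1 - v p.2) * s p.1 p.2))//.
  by meas.
rewrite -E.
have zero k : Rintegral pi setT (fun p => F p * cutoff k p.2) = 0.
  have -> : (fun p => F p * cutoff k p.2) = (fun p : V * V =>
    2^-1 * (H k (p.1 + p.2, - p.2) - H k p) + 2^-1 * (Q k (p.1, - p.2) - Q k p)).
    by apply/funext => p; exact: cutoff_decomposition.
  have iH := preserving_integrable flip_preserving (integrable_H k).
  have iQ := preserving_integrable (reflect_preserving Hmu) (integrable_Q k).
  have i1 := integrableD_EFin iH (integrableZ_EFin (-1) (integrable_H k)).
  have i2 := integrableD_EFin iQ (integrableZ_EFin (-1) (integrable_Q k)).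
  have j1 : pi.-integrable setT (EFin \o (fun p : V * V => H k (p.1 + p.2, - p.2) - H k p)).
    by apply: eq_integrable i1 => // p _ /=; rewrite mulN1r.
  have j2 : pi.-integrable setT (EFin \o (fun p : V * V => Q k (p.1, - p.2) - Q k p)).
    by apply: eq_integrable i2 => // p _ /=; rewrite mulN1r.
  rewrite RintegralD//; [|exact: integrableZ_EFin|exact: integrableZ_EFin].
  rewrite !RintegralZl// !RintegralB//; [|exact: integrable_Q|exact: integrable_H].
  rewrite (preserving_Rintegral flip_preserving (integrable_measurable (integrable_H k))).
  rewrite (preserving_Rintegral (reflect_preserving Hmu) (integrable_measurable (integrable_Q k))).
  by rewrite !subrr !mulr0 addr0.
have iaF : pi.-integrable setT (EFin \o (fun p => `|F p|)).
  by have := integrable_abse iF; apply: eq_integrable.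
have h : Rintegral pi setT (fun p => F p * cutoff k p.2) @[k --> \oo] --> Rintegral pi setT F.
  apply: (Rintegral_dominated _ mF _ iaF).
  - by move=> k; meas.
  (* At z = 0 every cutoff is 0, so convergence needs F(x, 0) = 0; this follows from [s_diag] and
     the linearity of the gradient term. *)
  - move=> [x z] /=; have [->|z0] := eqVneq z 0.
      have -> : F (x, 0) = 0.
        rewrite /F /T1 /T2 /T3 /= addr0 subr0 s_diag grad_dot0.
        by rewrite !(mul0r, mulr0, addr0).
      have -> : (fun k => 0 * cutoff k (0 : V)) = cst 0.
        by apply/funext => k; rewrite mul0r.
      exact: cvg_cst.
    rewrite -[X in _ --> X]mulr1; apply: cvgM; first exact: cvg_cst.
    exact: cutoff_cvg.
  - move=> k p; rewrite normrM ler_piMr//.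
    by rewrite ger0_norm ?cutoff_ge0// cutoff_le1.
have E0 : (fun k => Rintegral pi setT (fun p => F p * cutoff k p.2)) = cst 0.
  by apply/funext => k; exact: zero.
by rewrite E0 in h; rewrite -(cvg_lim _ h)// lim_cst.
Qed.
End symmetric_identity.

(** * The weak form of the generator *)

Section weak_identity.
Context (R : realType) (n : nat).
Local Notation V := 'rV[R]_n.
Variable mu : {sigma_finite_measure set V -> \bar R}.
Hypothesis Hmu : is_lebesgue mu.
Variables s a : V -> V -> R.
Hypothesis ms : measurable_fun setT (fun p : V * V => s p.1 p.2).
Hypothesis s_ge0 : forall x y, 0 <= s x y.
Hypothesis s_sym : forall x y, s x y = s y x.
Hypothesis s_diag : forall x, s x x = 0.
Hypothesis ma : measurable_fun setT (fun p : V * V => a p.1 p.2).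
Hypothesis a_anti : forall x y, a y x = - a x y.
Hypothesis a_le : forall x y, `|a x y| <= s x y.
Local Notation pi := (mu \x mu)%E.
Hypothesis levy_int : forall r, pi.-integrable setT (EFin \o (fun p : V * V =>
  ball_indic r p.1 * (Num.min 1 (enorm (p.2 - p.1) ^+ 2) * s p.1 p.2))).
Hypothesis jump_int : forall r, pi.-integrable setT (EFin \o (fun p : V * V =>
  ball_indic r p.1 * (unit_indic p.2 * (enorm p.2 *
    `|s p.1 (p.1 + p.2) - s p.1 (p.1 - p.2)|)))).
Variable M : R.
Hypothesis M_ge0 : 0 <= M.
Hypothesis a_int : forall x, (\int[mu]_y (a x y ^+ 2 / s x y)%:E <= M%:E)%E.

Implicit Types u v : V -> R.

Definition compensated_part (u : V -> R) (x : V) : R :=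
  Rintegral mu setT (fun z => taylor_rest u x z * s x (x + z)).
Definition asym_drift (i : 'I_n) (x : V) : R :=
  Rintegral mu setT (fun z => z ord0 i * (unit_indic z * (s x (x + z) - s x (x - z)))).
Definition antisymmetric_part (u : V -> R) (x : V) : R :=
  Rintegral mu setT (fun y => (u y - u x) * a x y).
(** The right-hand side of the formula with all integrals over the whole space; [LformulaE]
    identifies the two once the kernel is 0 on the diagonal. *)
Definition operator (u : V -> R) (x : V) : R :=
  compensated_part u x + 2^-1 * \sum_(i < n) partial i u x * asym_drift i x +
  antisymmetric_part u x.

Lemma measurable_ratio d (T : measurableType d) (f g : T -> V) :
  measurable_fun setT f -> measurable_fun setT g ->
  measurable_fun setT (fun t => a (f t) (g t) ^+ 2 / s (f t) (g t)).
Proof.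
move=> mf mg; apply: measurable_funM; first by meas.
by apply: measurable_fun_inv_ge0 => //; meas.
Qed.

Lemma ratio_ge0 x y : 0 <= a x y ^+ 2 / s x y.
Proof. by rewrite divr_ge0// sqr_ge0. Qed.

(** The bound [a_int] integrates out the second variable, where v also sits. Since a^2 / s is
    symmetric, the swap moves v to the first variable, and then the inner integral is at most M. *)
Lemma antisymmetric_weight v : measurable_fun setT v ->
  mu.-integrable setT (EFin \o (fun x => v x ^+ 2)) ->
  pi.-integrable setT (EFin \o (fun p : V * V => v p.2 ^+ 2 * (a p.1 p.2 ^+ 2 / s p.1 p.2))) /\
  Rintegral pi setT (fun p => v p.2 ^+ 2 * (a p.1 p.2 ^+ 2 / s p.1 p.2)) <=
    M * Rintegral mu setT (fun x => v x ^+ 2).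
Proof.
move=> mv iv.
pose G (p : V * V) := v p.1 ^+ 2 * (a p.1 p.2 ^+ 2 / s p.1 p.2).
have mr : measurable_fun setT (fun p : V * V => a p.1 p.2 ^+ 2 / s p.1 p.2).
  by apply: measurable_ratio; meas.
have mG : measurable_fun setT G by rewrite /G; apply: measurable_funM => //; meas.
have G0 p : 0 <= G p by rewrite /G mulr_ge0 ?sqr_ge0 ?ratio_ge0.
have vs0 x : 0 <= v x ^+ 2 by exact: sqr_ge0.
have mv2 : measurable_fun setT (EFin \o (fun x => v x ^+ 2)) by case/integrableP: iv.
have mrx x : measurable_fun setT (fun y => (a x y ^+ 2 / s x y)%:E).
  by apply/measurable_EFinP; apply: measurable_ratio; meas.
have r0 x : (0 <= \int[mu]_y (a x y ^+ 2 / s x y)%:E)%E.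
  by apply: integral_ge0 => y _; rewrite lee_fin ratio_ge0.
have EG x : fubini_F mu (EFin \o G) x =
    ((v x ^+ 2)%:E * \int[mu]_y (a x y ^+ 2 / s x y)%:E)%E.
  transitivity (\int[mu]_y ((v x ^+ 2)%:E * (a x y ^+ 2 / s x y)%:E))%E.
    by apply: eq_integral => y _; rewrite /= EFinM.
  apply: (@ge0_integralZl _ _ _ mu setT measurableT _ (mrx x)).
  - by move=> y _; rewrite lee_fin ratio_ge0.
  - by rewrite lee_fin.
have Gle : (\int[pi]_p (G p)%:E <= (M * Rintegral mu setT (fun x => v x ^+ 2))%:E)%E.
  rewrite (fubini_tonelli1 (EFin \o G))//; last exact/measurable_EFinP.
  rewrite EFinM -Rintegral_EFin// muleC.
  have <- : (\int[mu]_x ((v x ^+ 2)%:E * M%:E) = (\int[mu]_x (v x ^+ 2)%:E) * M%:E)%E.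
    apply: (@ge0_integralZr _ _ _ mu setT measurableT _ mv2).
    - by move=> x _; rewrite lee_fin.
    - by rewrite lee_fin.
  apply: ge0_le_integral => //.
  - by move=> x _; rewrite EG mule_ge0// lee_fin.
  - apply: (@measurable_fun_fubini_tonelli_F _ _ _ _ _ _ (EFin \o G)) => //.
    exact/measurable_EFinP.
  - exact: emeasurable_funM.
  by move=> x _; rewrite EG; apply: lee_wpmul2l; rewrite ?lee_fin.
have iG : pi.-integrable setT (EFin \o G).
  by apply: integrable_ge0_lty => //; apply: le_lt_trans Gle _; exact: ltry.
have E : (fun p : V * V => v p.2 ^+ 2 * (a p.1 p.2 ^+ 2 / s p.1 p.2)) =
    (fun p => G (p.2, p.1)).
  by apply/funext => p; rewrite /G /= a_anti sqrrN s_sym.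
rewrite E; split; first exact: (preserving_integrable (swap_preserving mu) iG).
rewrite (preserving_Rintegral (swap_preserving mu) mG) -lee_fin -Rintegral_EFin//.
Qed.

Lemma antisymmetric_form u v : measurable_fun setT u -> measurable_fun setT v ->
  pi.-integrable setT (EFin \o energy s u) ->
  mu.-integrable setT (EFin \o (fun x => v x ^+ 2)) ->
  pi.-integrable setT (EFin \o (fun p : V * V => (u p.1 - u p.2) * v p.2 * a p.1 p.2)) /\
  (Rintegral pi setT (fun p => (u p.1 - u p.2) * v p.2 * a p.1 p.2)) ^+ 2 <=
    Rintegral pi setT (energy s u) * (M * Rintegral mu setT (fun x => v x ^+ 2)).
Proof.
move=> mu_ mv iu iv; have [iw wle] := antisymmetric_weight mv iv.
have [] := @weighted_cauchy_schwarz _ _ _ pi (fun p => u p.1 - u p.2)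
  (fun p => v p.2) (fun p => s p.1 p.2) (fun p => a p.1 p.2) => //; try by meas.
move=> i1 le1; split=> //; apply: le_trans le1 _; apply: ler_wpM2l => //.
by apply: Rintegral_ge0 => p _; rewrite mulr_ge0// sqr_ge0.
Qed.

Lemma Cc_lip_square_integrable v : Cc_lip v ->
  mu.-integrable setT (EFin \o (fun x => v x ^+ 2)).
Proof.
move=> hv; have mv := Cc_lip_measurable hv.
have [r [C [C0 vr vC _]]] := Cc_lip_bounds hv.
have ib : mu.-integrable setT (EFin \o (ball_indic r : V -> R)).
  apply: integrable_ge0_lty; [exact: measurable_ball_indic|exact: ball_indic_ge0|].
  under eq_integral do rewrite -[(ball_indic r _)%:E]mule1.
  rewrite ball_indic_integral integral_cst ?mul1e; last exact: enorm_ball_measurable.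
  exact: bounded_finite_measure.
apply: (integrable_le _ _ (integrableZ_EFin (C ^+ 2) ib)); first by meas.
move=> x; rewrite ger0_norm ?sqr_ge0//.
have [xr|xr] := leP (enorm x) r.
  rewrite /ball_indic xr mulr1 -(real_normK (num_real (v x))).
  by have := vC x; have := normr_ge0 (v x); nra.
by rewrite vr// expr0n /= mulr_ge0 ?sqr_ge0 ?ball_indic_ge0.
Qed.

(** [Rintegral_slices] writes each part of the operator, tested against v, as a double integral. The
    symmetric ones cancel against half the energy by [Rintegral_symmetric_identity]; the
    antisymmetric one is the second term of the form after exchanging x and y. *)
Lemma weak_identity u v : C2c u -> Cc_lip v ->
  mu.-integrable setT (EFin \o (fun x => operator u x * v x)) /\
  2^-1 * Rintegral pi setT (fun p => (u p.1 - u p.2) * (v p.1 - v p.2) * s p.1 p.2) +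
  Rintegral pi setT (fun p => (u p.1 - u p.2) * v p.2 * a p.1 p.2) =
  - Rintegral mu setT (fun x => operator u x * v x).
Proof.
move=> hu hv.
have mu_ := C2c_measurable hu; have mv := Cc_lip_measurable hv.
have mg : measurable_fun setT (fun p : V * V => grad_dot u p.1 p.2).
  by apply: measurable_grad_dot => //; meas.
have mt : measurable_fun setT (fun p : V * V => taylor_rest u p.1 p.2).
  by apply: measurable_taylor_rest => //; meas.
have mi : measurable_fun setT (@unit_indic R n).
  by apply: measurable_unit_indic; meas.
have mp i := partial_measurable hu i.
have [iA EA] := @Rintegral_slices _ _ _ mu v
  (fun p => taylor_rest u p.1 p.2 * s p.1 (p.1 + p.2)) mv ltac:(meas)
  (integrable_T2 Hmu ms s_ge0 levy_int hu hv).
pose J i (p : V * V) := p.2 ord0 i * (unit_indic p.2 * (s p.1 (p.1 + p.2) - s p.1 (p.1 - p.2))).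
have mJ i : measurable_fun setT (J i) by rewrite /J; meas.
(* The formula integrates the drift coordinate by coordinate, so Fubini is needed for each i
   separately; |z_i| <= |z| brings every coordinate under [jump_int]. *)
have iJ i : pi.-integrable setT (EFin \o (fun p : V * V => (v p.1 * partial i u p.1) * J i p)).
  have [r [C [C0 vr vC _]]] := Cc_lip_bounds hv.
  have [_ [D [D0 _ _ _ [uD _ _]]]] := C2c_bounds hu.
  have mpi := mp i; have mJi := mJ i.
  apply: (integrable_le _ _ (integrableZ_EFin (C * D) (jump_int r))).
    by apply: measurable_funM => //; meas.
  move=> [x z] /=; rewrite /J /=.
  have [xr|xr] := leP (enorm x) r; last first.
    rewrite vr// !mul0r normr0 !mulr_ge0 ?ball_indic_ge0 ?unit_indic_ge0 ?enorm_ge0//.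
  rewrite /ball_indic xr mul1r 4!normrM (ger0_norm (unit_indic_ge0 z)).
  rewrite [unit_indic z * (enorm z * _)]mulrCA.
  apply: ler_pM.
  - by rewrite mulr_ge0.
  - by rewrite !mulr_ge0// unit_indic_ge0.
  - by apply: ler_pM.
  - by rewrite ler_wpM2r ?coord_le_enorm// mulr_ge0// unit_indic_ge0.
have mvp i : measurable_fun setT (fun x => v x * partial i u x).
  by have mpi := mp i; meas.
have sJ i := @Rintegral_slices _ _ _ mu _ (J i) (mvp i) (mJ i) (iJ i).
pose K (p : V * V) := v p.1 * ((u p.2 - u p.1) * a p.1 p.2).
have [iC _] := antisymmetric_form mu_ mv
  (energy_integrable ms s_ge0 s_sym levy_int (C2c_Cc_lip hu)) (Cc_lip_square_integrable hv).
(* The form evaluates v at the second point and the operator at the first; antisymmetry of a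
   accounts for the sign under the swap. *)
have EK : (fun p : V * V => (u p.1 - u p.2) * v p.2 * a p.1 p.2) =
    (fun p => - K (p.2, p.1)).
  by apply/funext => p; rewrite /K /= (a_anti p.1 p.2); ring.
have EK' : K = (fun p => - ((u p.2 - u p.1) * v p.1 * a p.2 p.1)).
  by apply/funext => p; rewrite /K /= (a_anti p.1 p.2); ring.
have iK : pi.-integrable setT (EFin \o K).
  have := integrableZ_EFin (-1) (preserving_integrable (swap_preserving mu) iC).
  by apply: eq_integrable => // p _ /=; rewrite EK' mulN1r.
have [iCs EC] := @Rintegral_slices _ _ _ mu v
  (fun p => (u p.2 - u p.1) * a p.1 p.2) mv ltac:(meas) iK.
have iR i : mu.-integrable setT (EFin \o (fun x => (v x * partial i u x) * asym_drift i x)).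
  exact: (sJ i).1.
have [iS ES] := Rintegral_sum (index_enum 'I_n) iR.
have E : (fun x => operator u x * v x) = (fun x => v x * compensated_part u x +
    2^-1 * (\sum_i (v x * partial i u x) * asym_drift i x) + v x * antisymmetric_part u x).
  apply/funext => x; rewrite /operator.
  have -> : \sum_i v x * partial i u x * asym_drift i x =
      v x * \sum_i partial i u x * asym_drift i x.
    by rewrite mulr_sumr; apply: eq_bigr => i _; rewrite mulrA.
  ring.
have iS' := integrableZ_EFin 2^-1 iS.
have iAS := integrableD_EFin iA iS'.
rewrite E; split; first exact: (integrableD_EFin iAS iCs).
rewrite RintegralD// RintegralD// RintegralZl// ES EA EC.
have -> : \sum_i Rintegral mu setT (fun x => v x * partial i u x * asym_drift i x) =
    Rintegral pi setT (fun p => v p.1 * (grad_dot u p.1 p.2 *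
      (unit_indic p.2 * (s p.1 (p.1 + p.2) - s p.1 (p.1 - p.2))))).
  have [_ ESJ] := Rintegral_sum (index_enum 'I_n) iJ.
  transitivity (\sum_i Rintegral pi setT (fun p => (v p.1 * partial i u p.1) * J i p)).
    by apply: eq_bigr => i _; exact: (sJ i).2.
  rewrite -ESJ; apply: eq_Rintegral => p _; rewrite /grad_dot mulr_suml mulr_sumr.
  by apply: eq_bigr => i _; rewrite /J; ring.
have -> : Rintegral pi setT (fun p => (u p.1 - u p.2) * v p.2 * a p.1 p.2) =
    - Rintegral pi setT K.
  rewrite EK -mulN1r -RintegralZl//.
  rewrite -(preserving_Rintegral (swap_preserving mu) (f := fun p => -1 * K p)).
    by apply: eq_Rintegral => p _; rewrite mulN1r.
  by apply: measurable_funM => //; exact: integrable_measurable iK.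
have := Rintegral_symmetric_identity Hmu ms s_ge0 s_sym s_diag levy_int jump_int hu hv.
rewrite /K; lra.
Qed.
End weak_identity.

(** * Square integrability of the generator *)

(** No integrability is required, because [fine] sends an infinite integral to 0. The bound is thus
    available at every x in the pointwise estimates of the operator. *)
Lemma normr_Rintegral_le d (T : measurableType d) (R : realType)
    (m : {measure set T -> \bar R}) (f : T -> R) : measurable_fun setT f ->
  (`|Rintegral m setT f|%:E <= \int[m]_x (`|f x|)%:E)%E.
Proof.
move=> mf; apply: (@le_trans _ _ (`|\int[m]_x (f x)%:E|)%E).
  rewrite /Rintegral; case: (\int[m]_x (f x)%:E)%E => [r| |] //=.
  - by rewrite normr0 leey.
  - by rewrite normr0 leey.
apply: (le_abse_integral _ measurableT (f := EFin \o f)).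
exact/measurable_EFinP.
Qed.

Section L2_lemmas.
Context (R : realType) (n : nat).
Local Notation V := 'rV[R]_n.
Variable mu : {measure set V -> \bar R}.

(** The dominating functions are extended real because slice integrals may be infinite at some
    points. At finite values the estimate is (a + b)^2 <= 2 a^2 + 2 b^2. *)
Lemma L2_dominated (f : V -> R) (p q : V -> \bar R) : measurable_fun setT f ->
  L2e mu p -> L2e mu q -> (forall x, 0 <= p x)%E -> (forall x, 0 <= q x)%E ->
  (forall x, (`|f x|)%:E <= p x + q x)%E -> L2 mu f.
Proof.
move=> mf [mp pp] [mq qq] p0 q0 fpq; split => //.
have mpp : measurable_fun setT (fun x => 2%:E * (p x * p x))%E.
  by apply: emeasurable_funM => //; exact: emeasurable_funM.
have mqq : measurable_fun setT (fun x => 2%:E * (q x * q x))%E.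
  by apply: emeasurable_funM => //; exact: emeasurable_funM.
apply: (@le_lt_trans _ _ (\int[mu]_x (2%:E * (p x * p x) + 2%:E * (q x * q x)))%E).
  apply: ge0_le_integral => //.
  - by move=> x _; rewrite lee_fin sqr_ge0.
  - by apply/measurable_EFinP; exact: measurable_funX.
  - exact: emeasurable_funD.
  - move=> x _; move: (fpq x) (p0 x) (q0 x).
    rewrite -(real_normK (num_real (f x))); move: (normr_ge0 (f x)).
    case: (p x) => [a| |]; case: (q x) => [b| |] //= f0.
    + rewrite -!EFinM -!EFinD !lee_fin => fab a0 b0.
      have : `|f x| ^+ 2 <= (a + b) ^+ 2 by rewrite lerXn2r// nnegrE addr_ge0.
      by have := sqr_ge0 (a - b); nra.
    + by move=> _ a0 _; rewrite -!EFinM mulyy gt0_muley ?lte_fin// addey// leey.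
    + by move=> _ _ b0; rewrite -!EFinM mulyy gt0_muley ?lte_fin// addye// leey.
    + by move=> _ _ _; rewrite mulyy gt0_muley ?lte_fin// leey.
rewrite ge0_integralD//; last 2 first.
- by move=> x _; rewrite !mule_ge0.
- by move=> x _; rewrite !mule_ge0.
rewrite !ge0_integralZl//; first by rewrite lte_add_pinfty// lte_mul_pinfty.
- exact: emeasurable_funM.
- by move=> x _; rewrite mule_ge0.
- exact: emeasurable_funM.
- by move=> x _; rewrite mule_ge0.
Qed.

Lemma L2_L2e (f : V -> R) : L2 mu f -> L2e mu (fun x => (`|f x|)%:E).
Proof.
move=> [mf foo]; split; first by apply/measurable_EFinP; exact: measurable_fun_normr.
by under eq_integral do rewrite -EFinM -expr2 real_normK ?num_real//.
Qed.

Lemma L2D (f g : V -> R) : L2 mu f -> L2 mu g -> L2 mu (fun x => f x + g x).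
Proof.
move=> hf hg; apply: (L2_dominated _ (L2_L2e hf) (L2_L2e hg)).
- by apply: measurable_funD; [case: hf|case: hg].
- by move=> x; rewrite lee_fin.
- by move=> x; rewrite lee_fin.
- by move=> x; rewrite -EFinD lee_fin ler_normD.
Qed.

Lemma L2e0 : L2e mu (cst 0)%E.
Proof.
split; first exact: measurable_cst.
by under eq_integral do rewrite mule0; rewrite integral0.
Qed.

Lemma L2_sum (I : Type) (r : seq I) (f : I -> V -> R) : (forall i, L2 mu (f i)) ->
  L2 mu (fun x => \sum_(i <- r) f i x).
Proof.
move=> hf; elim: r => [|i r IH].
  have -> : (fun x => \sum_(i <- [::]) f i x) = cst 0.
    by apply/funext => x; rewrite big_nil.
  split; first exact: measurable_cst.
  by under eq_integral do rewrite expr0n; rewrite integral0.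
have -> : (fun x => \sum_(j <- i :: r) f j x) =
    (fun x => f i x + \sum_(j <- r) f j x).
  by apply/funext => x; rewrite big_cons.
exact: L2D.
Qed.

Lemma L2_scale c (f : V -> R) : L2 mu f -> L2 mu (fun x => c * f x).
Proof.
move=> [mf foo]; split; first exact: measurable_funM.
under eq_integral do rewrite exprMn EFinM.
rewrite ge0_integralZl//; first by rewrite lte_mul_pinfty// lee_fin sqr_ge0.
- by apply/measurable_EFinP; exact: measurable_funX.
- by move=> x _; rewrite lee_fin sqr_ge0.
- by rewrite lee_fin sqr_ge0.
Qed.

Lemma L2_integrable (f : V -> R) : L2 mu f ->
  mu.-integrable setT (EFin \o (fun x => f x ^+ 2)).
Proof.
move=> [mf foo]; apply: integrable_ge0_lty => // [|x]; last exact: sqr_ge0.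
exact: measurable_funX.
Qed.
End L2_lemmas.

Section local_L2.
Context (R : realType) (n : nat).
Local Notation V := 'rV[R]_n.
Variable mu : {sigma_finite_measure set V -> \bar R}.

Lemma measurable_nonneg_slices (G : V * V -> R) : measurable_fun setT G ->
  (forall p, 0 <= G p) -> measurable_fun setT (fun x => \int[mu]_y (G (x, y))%:E)%E.
Proof.
move=> mG G0; apply: (@measurable_fun_fubini_tonelli_F _ _ _ _ _ _ (EFin \o G)).
  exact/measurable_EFinP.
by move=> p; rewrite lee_fin.
Qed.

Lemma nonneg_iterated_lty (G : V * V -> R) :
  (mu \x mu)%E.-integrable setT (EFin \o G) -> (forall p, 0 <= G p) ->
  (\int[mu]_x \int[mu]_y (G (x, y))%:E < +oo)%E.
Proof.
move=> iG G0; have := (integrable12ltyP mu mu (measurable_int _ iG)).1 iG.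
apply: le_lt_trans; rewrite le_eqVlt; apply/orP; left; apply/eqP.
apply: eq_integral => x _; apply: eq_integral => y _ /=.
by rewrite ger0_norm.
Qed.

Lemma L2e_local r (K : R) (G : V * V -> R) : measurable_fun setT G ->
  (forall p, 0 <= G p) -> 0 <= K ->
  (\int[mu]_(x in [set x | (enorm x <= r)%R])
     ((\int[mu]_y (G (x, y))%:E) * (\int[mu]_y (G (x, y))%:E)) < +oo)%E ->
  L2e mu (fun x => (K * ball_indic r x)%:E * \int[mu]_y (G (x, y))%:E)%E.
Proof.
move=> mG G0 K0 Goo; have mg := measurable_nonneg_slices mG G0.
have g0 x : (0 <= \int[mu]_y (G (x, y))%:E)%E by apply: integral_ge0 => y _; rewrite lee_fin.
split.
  apply: emeasurable_funM => //; apply/measurable_EFinP.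
  apply: measurable_funM; [exact: measurable_cst|exact: measurable_ball_indic].
have E x : ((K * ball_indic r x)%:E * (\int[mu]_y (G (x, y))%:E) *
   ((K * ball_indic r x)%:E * \int[mu]_y (G (x, y))%:E) =
   (K ^+ 2)%:E * ((ball_indic r x)%:E *
     ((\int[mu]_y (G (x, y))%:E) * \int[mu]_y (G (x, y))%:E)))%E.
  rewrite muleACA -EFinM.
  have -> : K * ball_indic r x * (K * ball_indic r x) = K ^+ 2 * ball_indic r x.
    by rewrite /ball_indic; case: ifP => _; ring.
  by rewrite EFinM -muleA.
under eq_integral do rewrite E.
rewrite ge0_integralZl//.
- by rewrite ball_indic_integral lte_mul_pinfty// lee_fin sqr_ge0.
- apply: emeasurable_funM; last exact: emeasurable_funM.
  by apply/measurable_EFinP; exact: measurable_ball_indic.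
- by move=> x _; rewrite !mule_ge0// lee_fin ball_indic_ge0.
- by rewrite lee_fin sqr_ge0.
Qed.
End local_L2.

Section operator_L2.
Context (R : realType) (n : nat).
Local Notation V := 'rV[R]_n.
Variable mu : {sigma_finite_measure set V -> \bar R}.
Hypothesis Hmu : is_lebesgue mu.
Variables s a : V -> V -> R.
Hypothesis ms : measurable_fun setT (fun p : V * V => s p.1 p.2).
Hypothesis s_ge0 : forall x y, 0 <= s x y.
Hypothesis s_sym : forall x y, s x y = s y x.
Hypothesis ma : measurable_fun setT (fun p : V * V => a p.1 p.2).
Hypothesis a_le : forall x y, `|a x y| <= s x y.
Hypothesis levy_loc : forall r, (\int[mu]_(x in [set x | (enorm x <= r)%R])
  ((\int[mu]_y (Num.min 1 (enorm (y - x) ^+ 2) * s x y)%:E) *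
   (\int[mu]_y (Num.min 1 (enorm (y - x) ^+ 2) * s x y)%:E)) < +oo)%E.
Hypothesis jump_loc : forall r, (\int[mu]_(x in [set x | (enorm x <= r)%R])
  ((\int[mu]_z (unit_indic z * (enorm z * `|s x (x + z) - s x (x - z)|))%:E) *
   (\int[mu]_z (unit_indic z * (enorm z * `|s x (x + z) - s x (x - z)|))%:E)) < +oo)%E.

Definition far_indic (z : V) : R := if 1 <= enorm z then 1 else 0.

Let g3 x := (\int[mu]_y (far_indic (y - x) * s x y)%:E)%E.
Hypothesis tail : L2e mu g3 \/ exists N : R, {ae mu, forall x, (g3 x <= N%:E)%E}.
Variable M : R.
Hypothesis M_gt0 : 0 < M.
Hypothesis a_int : forall x, (\int[mu]_y (a x y ^+ 2 / s x y)%:E <= M%:E)%E.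
Local Notation pi := (mu \x mu)%E.
Implicit Types u : V -> R.

Let levy_int : forall r, pi.-integrable setT (EFin \o (fun p : V * V =>
  ball_indic r p.1 * (Num.min 1 (enorm (p.2 - p.1) ^+ 2) * s p.1 p.2))).
Proof.
move=> r; apply: (@locally_square_integrable _ _ _ Hmu
  (fun p => Num.min 1 (enorm (p.2 - p.1) ^+ 2) * s p.1 p.2)) => //.
  by meas.
by move=> p; rewrite mulr_ge0// le_min ler01 sqr_ge0.
Qed.

Lemma far_indic_ge0 z : 0 <= far_indic z.
Proof. by rewrite /far_indic; case: ifP. Qed.

Lemma far_indic_le_min z : far_indic z <= Num.min 1 (enorm z ^+ 2).
Proof.
rewrite /far_indic; case: ifP => h; last by rewrite le_min ler01 sqr_ge0.
by rewrite le_min lexx /=; have := enorm_ge0 z; nra.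
Qed.

Lemma far_indicN z : far_indic (- z) = far_indic z.
Proof. by rewrite /far_indic enormN. Qed.

Lemma measurable_far_indic : measurable_fun setT far_indic.
Proof. by rewrite /far_indic; meas. Qed.

(* When the tail [g3] is only essentially bounded by [N], the square of this function is at
   most [K * N] times itself, and it is integrable by Tonelli and the symmetry of [s]. *)
Lemma L2e_tail r K : 0 <= K ->
  L2e mu (fun x => \int[mu]_y (K * (ball_indic r y * (far_indic (y - x) * s x y)))%:E)%E.
Proof.
move=> K0; have mf := measurable_far_indic; have mb := @measurable_ball_indic R n r.
pose G (p : V * V) := K * (ball_indic r p.2 * (far_indic (p.2 - p.1) * s p.1 p.2)).
have mG : measurable_fun setT G by rewrite /G; meas.
have G0 p : 0 <= G p by rewrite !mulr_ge0// ?ball_indic_ge0 ?far_indic_ge0.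
have mq := measurable_nonneg_slices mu mG G0.
have mGx (x : V) : measurable_fun setT (fun y => (G (x, y))%:E).
  by apply/measurable_EFinP; apply: (measurableT_comp mG); exact: pair1_measurable.
pose q x := (\int[mu]_y (G (x, y))%:E)%E.
have q0 x : (0 <= q x)%E by apply: integral_ge0 => y _; rewrite lee_fin.
have q3 x : (q x <= K%:E * g3 x)%E.
  have mt : measurable_fun setT (fun y : V => (far_indic (y - x) * s x y)%:E).
    by apply/measurable_EFinP; meas.
  have <- : (\int[mu]_y (K%:E * (far_indic (y - x) * s x y)%:E) = K%:E * g3 x)%E.
    apply: (@ge0_integralZl _ _ _ mu setT measurableT _ mt).
    - by move=> y _; rewrite lee_fin mulr_ge0 ?far_indic_ge0.
    - by rewrite lee_fin.
  apply: ge0_le_integral => //.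
  - by move=> y _; rewrite lee_fin.
  - by apply/measurable_EFinP; meas.
  move=> y _; rewrite -EFinM lee_fin /G /= ler_wpM2l//.
  rewrite ler_piMl ?mulr_ge0 ?far_indic_ge0//.
  by rewrite /ball_indic; case: ifP.
have g30 x : (0 <= g3 x)%E.
  by apply: integral_ge0 => y _; rewrite lee_fin mulr_ge0 ?far_indic_ge0.
split; first exact: mq.
case: tail => [[m3 h3]|[N hN]].
  apply: (@le_lt_trans _ _ (\int[mu]_x ((K ^+ 2)%:E * (g3 x * g3 x)))%E).
    apply: ge0_le_integral => //.
    - by move=> x _; exact: (mule_ge0 (q0 x) (q0 x)).
    - exact: emeasurable_funM.
    - by apply: emeasurable_funM => //; exact: emeasurable_funM.
    move=> x _; apply: (le_trans (lee_pmul (q0 x) (q0 x) (q3 x) (q3 x))).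
    by rewrite muleACA -EFinM.
  rewrite ge0_integralZl//.
  - by rewrite lte_mul_pinfty// lee_fin sqr_ge0.
  - exact: emeasurable_funM.
  - by move=> x _; exact: (mule_ge0 _ _).
  - by rewrite lee_fin sqr_ge0.
have Goo : (\int[mu]_x q x < +oo)%E.
  have iG : pi.-integrable setT (EFin \o G).
    have i1 := preserving_integrable (swap_preserving mu) (levy_int r).
    apply: (integrable_le _ _ (integrableZ_EFin K i1)) => //.
    move=> [x y] /=; rewrite /G /= ger0_norm; last by exact: (G0 (x, y)).
    rewrite ler_wpM2l// ler_wpM2l ?ball_indic_ge0// (s_sym y x) ler_wpM2r//.
    by rewrite -far_indicN opprB far_indic_le_min.
  exact: nonneg_iterated_lty.
have N0 : exists N' : R, 0 <= N' /\ {ae mu, forall x, (g3 x <= N'%:E)%E}.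
  exists `|N|; split => //; move: hN; apply: filterS => x /le_trans; apply.
  by rewrite lee_fin ler_norm.
move: N0 => [N' [N'0 hN']].
apply: (@le_lt_trans _ _ (\int[mu]_x ((K * N')%:E * q x))%E).
  apply: ae_ge0_le_integral => //.
  - by move=> x _; exact: (mule_ge0 (q0 x) (q0 x)).
  - exact: emeasurable_funM.
  - by move=> x _; rewrite mule_ge0// lee_fin mulr_ge0.
  - by apply: emeasurable_funM.
  move: hN'; apply: filterS => x gN _; apply: lee_wpmul2r; first exact: q0.
  by apply: le_trans (q3 x) _; rewrite EFinM lee_wpmul2l// lee_fin.
rewrite ge0_integralZl//; first by rewrite lte_mul_pinfty// lee_fin mulr_ge0.
by rewrite lee_fin mulr_ge0.
Qed.

(** Cauchy-Schwarz in y for fixed x bounds the square at x by M times the slice of the energy, and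
    the energy of u is integrable on the product. *)
Lemma L2_antisymmetric_part u : C2c u -> L2 mu (antisymmetric_part mu a u).
Proof.
move=> hu; have mu_ := C2c_measurable hu.
have ie := energy_integrable ms s_ge0 s_sym levy_int (C2c_Cc_lip hu).
have me := integrable_measurable ie.
have e0 p : 0 <= energy s u p by rewrite mulr_ge0// sqr_ge0.
have mex (x : V) : measurable_fun setT (fun y => energy s u (x, y)).
  by apply: (measurableT_comp me); exact: pair1_measurable.
have mra (x : V) : measurable_fun setT (fun y => a x y ^+ 2 / s x y).
  by apply: measurable_ratio => //; meas.
split.
  apply: (@measurable_Rintegral _ _ _ mu (fun p => (u p.2 - u p.1) * a p.1 p.2)).
  by meas.
apply: (@le_lt_trans _ _ (\int[mu]_x (M%:E * \int[mu]_y (energy s u (x, y))%:E))%E); last first.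
  rewrite ge0_integralZl//.
  - rewrite lte_mul_pinfty ?lee_fin ?ltW//.
    exact: nonneg_iterated_lty.
  - exact: measurable_nonneg_slices.
  - by move=> x _; apply: integral_ge0 => y _; rewrite lee_fin.
  - by rewrite lee_fin ltW.
apply: ge0_le_integral => //.
- by move=> x _; rewrite lee_fin sqr_ge0.
- apply/measurable_EFinP; apply: measurable_funX.
  apply: (@measurable_Rintegral _ _ _ mu (fun p => (u p.2 - u p.1) * a p.1 p.2)).
  by meas.
- by apply: emeasurable_funM => //; exact: measurable_nonneg_slices.
move=> x _.
(* On slices of infinite energy the bound is trivial, as M > 0 makes the right-hand side
   infinite. *)
have [eoo|eoo] := ltP (\int[mu]_y (energy s u (x, y))%:E)%E +oo%E; last first.
  move: eoo; rewrite leye_eq => /eqP ->.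
  by rewrite gt0_muley ?lte_fin// leey.
have iex : mu.-integrable setT (EFin \o (fun y => energy s u (x, y))).
  exact: integrable_ge0_lty.
have ira : mu.-integrable setT (EFin \o (fun y => a x y ^+ 2 / s x y)).
  apply: integrable_ge0_lty => //.
    by move=> y; rewrite divr_ge0// sqr_ge0.
  by apply: le_lt_trans (a_int x) _; exact: ltry.
rewrite Rintegral_EFin// -EFinM lee_fin.
have [] := @weighted_cauchy_schwarz _ _ _ mu (fun y => u y - u x) (cst 1) (s x) (a x).
- by meas.
- exact: measurable_cst.
- by meas.
- by meas.
- exact: a_le.
- by apply: eq_integrable iex => // y _ /=; rewrite /energy /= -sqrrN opprB.
- by apply: eq_integrable ira => // y _ /=; rewrite expr1n mul1r.
move=> _.
have -> : Rintegral mu setT (fun y => (u y - u x) * cst 1 y * a x y) =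
    antisymmetric_part mu a u x.
  by apply: eq_Rintegral => y _; rewrite mulr1.
have -> : Rintegral mu setT (fun y => (u y - u x) ^+ 2 * s x y) =
    Rintegral mu setT (fun y => energy s u (x, y)).
  by apply: eq_Rintegral => y _; rewrite /energy /= -sqrrN opprB.
have -> : Rintegral mu setT (fun y => cst 1 y ^+ 2 * (a x y ^+ 2 / s x y)) =
    Rintegral mu setT (fun y => a x y ^+ 2 / s x y).
  by apply: eq_Rintegral => y _; rewrite expr1n mul1r.
move=> h; apply: le_trans h _; rewrite mulrC ler_wpM2r//.
  by apply: Rintegral_ge0 => y _.
by rewrite -lee_fin -Rintegral_EFin.
Qed.
(** Two bounds are added: within radius [rho] the Taylor estimate against the locally square
    integrable Levy weight, and beyond it, where only u(x + z) survives in the remainder, the tail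
    function of [L2e_tail]. *)
Lemma L2_compensated_part u : C2c u -> L2 mu (compensated_part mu s u).
Proof.
move=> hu; have [K [K0 tK]] := taylor_rest_bound hu.
have [r [C [C0 ur pr uC _]]] := C2c_bounds hu.
have mt : measurable_fun setT (fun p : V * V => taylor_rest u p.1 p.2).
  by apply: measurable_taylor_rest => //; meas.
have mf := measurable_far_indic; have mb := @measurable_ball_indic R n.
(* Beyond radius [rho], [x + z] can meet the support of [u] only if [1 <= enorm z]. *)
pose rho0 := enorm (const_mx (`|r| + 1) : V).
pose rho := Num.max r rho0.
pose G (p : V * V) := Num.min 1 (enorm (p.2 - p.1) ^+ 2) * s p.1 p.2.
have mG : measurable_fun setT G by rewrite /G; meas.
have G0 p : 0 <= G p by rewrite mulr_ge0// le_min ler01 sqr_ge0.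
have hp := L2e_local mG G0 K0 (levy_loc rho).
have hq := L2e_tail r C0.
apply: (L2_dominated _ hp hq).
- apply: (@measurable_Rintegral _ _ _ mu (fun p => taylor_rest u p.1 p.2 * s p.1 (p.1 + p.2))).
  by meas.
- move=> x; rewrite mule_ge0 ?lee_fin ?mulr_ge0 ?ball_indic_ge0//.
  by apply: integral_ge0 => y _; rewrite lee_fin G0.
- move=> x; apply: integral_ge0 => y _.
  by rewrite lee_fin !mulr_ge0 ?ball_indic_ge0 ?far_indic_ge0.
move=> x.
have mts : measurable_fun setT (fun z => taylor_rest u x z * s x (x + z)).
  apply: measurable_funM; last by meas.
  exact: (measurable_section x mt).
apply: (le_trans (normr_Rintegral_le mu mts)).
pose p1 (y : V) := (K * ball_indic rho x) * (Num.min 1 (enorm (y - x) ^+ 2) * s x y).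
pose p2 (y : V) := C * (ball_indic r y * (far_indic (y - x) * s x y)).
have mb' := mb r.
have m1 : measurable_fun setT p1 by rewrite /p1; meas.
have m2 : measurable_fun setT p2 by rewrite /p2; meas.
have p10 y : 0 <= p1 y.
  by rewrite /p1 !mulr_ge0 ?ball_indic_ge0// le_min ler01 sqr_ge0.
have p20 y : 0 <= p2 y by rewrite /p2 !mulr_ge0 ?ball_indic_ge0 ?far_indic_ge0.
have -> : ((K * ball_indic rho x)%:E * \int[mu]_y (G (x, y))%:E =
    \int[mu]_y (p1 y)%:E)%E.
  have mGx : measurable_fun setT (fun y : V => (G (x, y))%:E).
    by apply/measurable_EFinP; apply: (measurableT_comp mG); exact: pair1_measurable.
  transitivity (\int[mu]_y ((K * ball_indic rho x)%:E * (G (x, y))%:E))%E.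
    apply/esym; apply: (@ge0_integralZl _ _ _ mu setT measurableT _ mGx).
    - by move=> y _; rewrite lee_fin.
    - by rewrite lee_fin mulr_ge0// ball_indic_ge0.
  by apply: eq_integral => y _; rewrite -EFinM.
(* The bounds are integrals over the end point y, the remainder is an integral over the jump z;
   translation by x aligns them. *)
have -> : (\int[mu]_y (p1 y)%:E + \int[mu]_y (p2 y)%:E =
    \int[mu]_z ((p1 (x + z) + p2 (x + z))%:E))%E.
  have mE1 : measurable_fun setT (EFin \o p1) by exact/measurable_EFinP.
  have mE2 : measurable_fun setT (EFin \o p2) by exact/measurable_EFinP.
  have m12 : measurable_fun setT (fun y => (p1 y + p2 y)%:E).
    by apply/measurable_EFinP; exact: measurable_funD.
  rewrite (preserving_integral (shift_preserving Hmu x) m12).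
  under [in RHS]eq_integral do rewrite EFinD.
  rewrite ge0_integralD//.
  - by move=> y _; rewrite lee_fin.
  - by move=> y _; rewrite lee_fin.
apply: ge0_le_integral => //.
- by apply/measurable_EFinP; exact: measurable_fun_normr.
- apply/measurable_EFinP; apply: (measurableT_comp (measurable_funD m1 m2)).
  by meas.
move=> z _; rewrite lee_fin /p1 /p2 [x + z]addrC addrK -[z + x]addrC.
rewrite normrM (ger0_norm (s_ge0 _ _)) !mulrA -mulrDl ler_wpM2r//.
have f0 := far_indic_ge0 z; have bz0 := ball_indic_ge0 r (x + z).
have m0 : 0 <= Num.min 1 (enorm z ^+ 2) by rewrite le_min ler01 sqr_ge0.
have bf0 : 0 <= C * ball_indic r (x + z) * far_indic z by rewrite !mulr_ge0.
have [xrho|xrho] := leP (enorm x) rho.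
  rewrite {1}/ball_indic xrho mulr1; apply: le_trans (tK x z) _.
  by rewrite lerDl.
have xr : r < enorm x by apply: le_lt_trans xrho; rewrite le_max lexx.
rewrite /taylor_rest (ur x xr) subr0.
have -> : grad_dot u x z = 0 by rewrite /grad_dot big1// => i _; rewrite pr// mul0r.
rewrite mul0r subr0.
have [xzr|xzr] := leP (enorm (x + z)) r; last first.
  by rewrite ur// normr0 addr_ge0// !mulr_ge0// ball_indic_ge0.
suff z1 : 1 <= enorm z.
  rewrite {2}/ball_indic xzr /far_indic z1 !mulr1.
  apply: le_trans (uC _) _; rewrite lerDr; apply: mulr_ge0 => //.
  by apply: mulr_ge0 => //; exact: ball_indic_ge0.
rewrite leNgt; apply/negP => z1.
suff : enorm x <= rho0.
  by rewrite leNgt => /negP; apply; apply: le_lt_trans xrho; rewrite le_max lexx orbT.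
(* Coordinatewise |x_j| <= |x_j + z_j| + |z_j| <= |r| + 1, which is why [rho0] is the norm of a
   constant vector. *)
apply: enorm_le_coord => j; rewrite mxE [X in _ <= X]ger0_norm ?addr_ge0//.
have := coord_le_enorm (x + z) j; have := coord_le_enorm z j; rewrite mxE => zj xzj.
have -> : x ord0 j = (x ord0 j + z ord0 j) - z ord0 j by rewrite addrK.
apply: le_trans (ler_normB _ _) _; apply: lerD; last by lra.
by apply: le_trans xzj _; apply: le_trans xzr _; exact: ler_norm.
Qed.

(** The gradient of u vanishes outside a ball, so the local hypothesis on the jumps is enough and
    the second dominating function is 0. *)
Lemma L2_drift_part u : C2c u ->
  L2 mu (fun x => \sum_(i < n) partial i u x * asym_drift mu s i x).
Proof.
move=> hu; have [r [C [C0 ur pr uC [pC _ _]]]] := C2c_bounds hu.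
have mi : measurable_fun setT (@unit_indic R n) by apply: measurable_unit_indic; meas.
pose G (p : V * V) := unit_indic p.2 * (enorm p.2 * `|s p.1 (p.1 + p.2) - s p.1 (p.1 - p.2)|).
have mG : measurable_fun setT G by rewrite /G; meas.
have G0 p : 0 <= G p by rewrite !mulr_ge0 ?unit_indic_ge0 ?enorm_ge0.
have hp := L2e_local mG G0 C0 (jump_loc r).
apply: L2_sum => i; have mp := partial_measurable hu i.
pose J (p : V * V) := p.2 ord0 i * (unit_indic p.2 * (s p.1 (p.1 + p.2) - s p.1 (p.1 - p.2))).
have mJ : measurable_fun setT J by rewrite /J; meas.
have g0 x : (0 <= \int[mu]_y (G (x, y))%:E)%E.
  by apply: integral_ge0 => y _; rewrite lee_fin.
apply: (L2_dominated _ hp (L2e0 mu)) => //.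
- apply: measurable_funM => //; exact: (measurable_Rintegral mu mJ).
- by move=> x; rewrite mule_ge0// lee_fin mulr_ge0// ball_indic_ge0.
move=> x; rewrite adde0.
have [xr|xr] := leP (enorm x) r; last first.
  by rewrite pr// mul0r normr0 mule_ge0// lee_fin mulr_ge0// ball_indic_ge0.
rewrite /ball_indic xr mulr1 normrM EFinM; apply: lee_pmul => //.
  by rewrite lee_fin.
have mJx : measurable_fun setT (fun z => J (x, z)).
  by apply: (measurableT_comp mJ); exact: pair1_measurable.
apply: (le_trans (normr_Rintegral_le mu mJx)).
apply: ge0_le_integral => //.
- by apply/measurable_EFinP; exact: measurable_fun_normr.
- by apply/measurable_EFinP; apply: (measurableT_comp mG); exact: pair1_measurable.
move=> z _; rewrite lee_fin /J /G /= !normrM (ger0_norm (unit_indic_ge0 z)) mulrCA.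
rewrite ler_wpM2l ?unit_indic_ge0// ler_wpM2r//.
exact: coord_le_enorm.
Qed.

Lemma L2_operator u : C2c u -> L2 mu (operator mu s a u).
Proof.
move=> hu; apply: L2D; last exact: L2_antisymmetric_part.
by apply: L2D; [exact: L2_compensated_part|apply: L2_scale; exact: L2_drift_part].
Qed.
End operator_L2.

(** * Continuity of the form and conclusion *)

Section extension_by_zero.
Context d (T : measurableType d) (R : realType).
Variable m : {measure set T -> \bar R}.

Lemma integral_extend (D : set T) (f g : T -> R) : (forall y, D y -> f y = g y) ->
  (forall y, ~ D y -> g y = 0) ->
  (\int[m]_(y in D) (f y)%:E = \int[m]_y (g y)%:E)%E.
Proof.
move=> fg g0; rewrite integral_mkcond; apply: eq_integral => y _.
rewrite patchE; case: ifPn => [|] yD; first by rewrite fg//; exact: set_mem.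
by rewrite g0//; move: yD; rewrite notin_setE.
Qed.

Lemma Rintegral_extend (D : set T) (f g : T -> R) : (forall y, D y -> f y = g y) ->
  (forall y, ~ D y -> g y = 0) -> Rintegral m D f = Rintegral m setT g.
Proof. by move=> fg g0; congr fine; exact: integral_extend. Qed.
End extension_by_zero.

(** * Reduction to a kernel that vanishes on the diagonal *)

Section off_diagonal.
Context (R : realType) (n : nat).
Local Notation V := 'rV[R]_n.
Variable mu : {sigma_finite_measure set V -> \bar R}.
Variable k : V -> V -> R.
Implicit Types u v : V -> R.

(* Vanishing on the diagonal turns integrals over [y != x] into integrals over the space. *)
Definition offdiag (x y : V) : R := if x == y then 0 else k x y.
Local Notation s := (ks offdiag).
Local Notation a := (ka offdiag).

Lemma ks_offdiag x y : y != x -> ks k x y = s x y.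
Proof. by move=> yx; rewrite /ks /offdiag eq_sym (negbTE yx). Qed.

Lemma ka_offdiag x y : y != x -> ka k x y = a x y.
Proof. by move=> yx; rewrite /ka /offdiag eq_sym (negbTE yx). Qed.

Lemma ks_diag x : s x x = 0.
Proof. by rewrite /ks /offdiag eqxx addr0 mul0r. Qed.

Lemma ka_diag x : a x x = 0.
Proof. by rewrite /ka /offdiag eqxx subr0 mul0r. Qed.

Lemma ks_sym x y : s x y = s y x.
Proof. by rewrite /ks addrC. Qed.

Lemma ka_anti x y : a y x = - a x y.
Proof. by rewrite /ka -mulNr opprB. Qed.

Hypothesis Hk0 : forall x y, x != y -> 0 <= k x y.

Lemma offdiag_ge0 x y : 0 <= offdiag x y.
Proof. by rewrite /offdiag; case: eqVneq => // xy; exact: Hk0. Qed.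

Lemma ks_ge0 x y : 0 <= s x y.
Proof. by rewrite divr_ge0// addr_ge0// offdiag_ge0. Qed.

Lemma ka_le x y : `|a x y| <= s x y.
Proof.
have := offdiag_ge0 x y; have := offdiag_ge0 y x; rewrite /ka /ks => h1 h2.
by rewrite ler_norml; apply/andP; split; lra.
Qed.

Hypothesis Hkm : measurable_fun [set p : V * V | p.1 != p.2] (fun p => k p.1 p.2).

Lemma measurable_offdiag : measurable_fun setT (fun p : V * V => offdiag p.1 p.2).
Proof.
(* The complement of the diagonal is where the measurable function |x - y| is positive. *)
have mD : measurable [set p : V * V | p.1 != p.2].
  have -> : [set p : V * V | p.1 != p.2] =
      (fun p : V * V => enorm (p.1 - p.2)) @^-1` `]0, +oo[.
    by apply/seteqP; split => p /=; rewrite in_itv /= andbT lt0r enorm_ge0 andbT enorm_eq0 subr_eq0.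
  have me : measurable_fun setT (fun p : V * V => enorm (p.1 - p.2)) by meas.
  by have := me measurableT _ (measurable_itv `]0, +oo[); rewrite setTI.
have mK : measurable_fun setT ((fun p : V * V => k p.1 p.2) \_ [set p : V * V | p.1 != p.2]).
  exact/(measurable_restrictT _ mD).
apply: eq_measurable_fun mK => p _; rewrite patchE /offdiag.
have [h|h] := eqVneq p.1 p.2; first by rewrite memNset//= h eqxx.
by rewrite mem_set.
Qed.

Lemma measurable_ks : measurable_fun setT (fun p : V * V => s p.1 p.2).
Proof. by have mk := measurable_offdiag; rewrite /ks; meas. Qed.

Lemma measurable_ka : measurable_fun setT (fun p : V * V => a p.1 p.2).
Proof. by have mk := measurable_offdiag; rewrite /ka; meas. Qed.

Lemma EformE u v : Eform mu k u v =
  (\int[mu]_x \int[mu]_y ((u x - u y) * (v x - v y) * s x y)%:E)%E.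
Proof.
apply: eq_integral => x _; apply: integral_extend => y /=.
  by move=> yx; rewrite ks_offdiag.
by move=> /negP; rewrite negbK => /eqP ->; rewrite ks_diag mulr0.
Qed.

Lemma asym_formE u v :
  (\int[mu]_x \int[mu]_(y in [set y | y != x]) ((u x - u y) * v y * ka k x y)%:E =
   \int[mu]_x \int[mu]_y ((u x - u y) * v y * a x y)%:E)%E.
Proof.
apply: eq_integral => x _; apply: integral_extend => y /=.
  by move=> yx; rewrite ka_offdiag.
by move=> /negP; rewrite negbK => /eqP ->; rewrite ka_diag mulr0.
Qed.

Lemma LformulaE u x : Lformula mu k u x = operator mu s a u x.
Proof.
have xz (z : V) : z != 0 -> x + z != x by rewrite -[x + z == x]subr_eq0 addrAC subrr add0r.
rewrite /Lformula /operator; congr (_ + _ + _).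
- apply: Rintegral_extend => z /=.
    by move=> z0; rewrite ks_offdiag// xz.
  by move=> /negP; rewrite negbK => /eqP ->; rewrite addr0 ks_diag mulr0.
- congr (_ * _); apply: eq_bigr => i _; congr (_ * _).
  apply: Rintegral_extend => z /=.
    move=> /andP[z0 z1]; have zn0 : z != 0 by rewrite -enorm_eq0 gt_eqF.
    have z2 : - z != 0 by rewrite oppr_eq0.
    by rewrite /unit_indic z1 mul1r (ks_offdiag (xz _ zn0)) (ks_offdiag (xz _ z2)).
  move=> /negP; rewrite negb_and -leNgt -ltNge => /orP[z0|z1].
    have /eqP -> : z == 0 by rewrite -enorm_eq0 eq_le z0 enorm_ge0.
    by rewrite mxE mul0r.
  by rewrite /unit_indic leNgt z1 mul0r mulr0.
- apply: Rintegral_extend => y /=.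
    by move=> yx; rewrite ka_offdiag.
  by move=> /negP; rewrite negbK => /eqP ->; rewrite ka_diag mulr0.
Qed.
End off_diagonal.

Lemma scaled_product_le (R : realFieldType) (c x y X Y : R) : 0 <= c ->
  0 <= x -> x <= X -> 0 <= y -> y <= Y -> c * x * y <= c * Y * X.
Proof. by move=> c0 x0 xX y0 yY; rewrite -!mulrA ler_wpM2l// mulrC ler_pM. Qed.

(** It follows from (x - y)^2 <= 2 x^2 + 2 y^2; the summand 1 makes the final inequality strict. *)
Lemma abs_sub_lt (R : realFieldType) (x y e d P Q : R) : 0 < e -> 0 < d ->
  x ^+ 2 <= P * d -> y ^+ 2 <= Q * d -> d * (2 * (P + Q) + 1) <= e ^+ 2 -> `|x - y| < e.
Proof.
move=> e0 d0 xP yQ de; rewrite -(ltr_pXn2r (n := 2))// ?nnegrE ?ltW//.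
rewrite real_normK ?num_real//.
by have := sqr_ge0 (x + y); nra.
Qed.

(** * Energy estimates and passage to the limit *)

Section form_continuity.
Context (R : realType) (n : nat).
Local Notation V := 'rV[R]_n.
Variable mu : {sigma_finite_measure set V -> \bar R}.
Hypothesis Hmu : is_lebesgue mu.
Variable k : V -> V -> R.
Hypothesis Hk0 : forall x y, x != y -> 0 <= k x y.
Hypothesis Hkm : measurable_fun [set p : V * V | p.1 != p.2] (fun p => k p.1 p.2).
Local Notation s := (ks (offdiag k)).
Local Notation a := (ka (offdiag k)).
Local Notation pi := (mu \x mu)%E.
Variable M : R.
Hypothesis M_ge0 : 0 <= M.
Hypothesis a_int : forall x, (\int[mu]_y (a x y ^+ 2 / s x y)%:E <= M%:E)%E.
Implicit Types u v w : V -> R.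

Let ms := measurable_ks Hkm.
Let ma := measurable_ka Hkm.
Let s_ge0 := ks_ge0 Hk0.
Let a_le := ka_le Hk0.

(** This is the space F^r, expressed by integrability on the product. It contains both C_c^lip and
    F^0 and is closed under differences, so all estimates are made in it. *)
Definition finite_energy w : Prop := [/\ measurable_fun setT w,
  pi.-integrable setT (EFin \o energy s w) &
  mu.-integrable setT (EFin \o (fun x => w x ^+ 2))].

Definition energy_norm2 w : R :=
  Rintegral pi setT (energy s w) + Rintegral mu setT (fun x => w x ^+ 2).

Lemma energy_ge0 w p : 0 <= energy s w p.
Proof. by rewrite mulr_ge0// sqr_ge0. Qed.

Lemma Rintegral_energy_ge0 w : 0 <= Rintegral pi setT (energy s w).
Proof. by apply: Rintegral_ge0 => p _; exact: energy_ge0. Qed.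

Lemma Rintegral_sqr_ge0 w : 0 <= Rintegral mu setT (fun x => w x ^+ 2).
Proof. by apply: Rintegral_ge0 => x _; exact: sqr_ge0. Qed.

Lemma energy_norm2_ge0 w : 0 <= energy_norm2 w.
Proof. by rewrite addr_ge0 ?Rintegral_energy_ge0 ?Rintegral_sqr_ge0. Qed.

Lemma EformE_energy w : Eform mu k w w = (\int[mu]_x \int[mu]_y (energy s w (x, y))%:E)%E.
Proof. by rewrite EformE. Qed.

Lemma Fnorm2E w : finite_energy w -> Fnorm2 mu k w = (energy_norm2 w)%:E.
Proof.
move=> [mw iw jw]; rewrite /Fnorm2 EformE_energy /energy_norm2 EFinD; congr (_ + _)%E.
  rewrite -(Rintegral_fubini iw) fineK//.
  rewrite (integral12_prod_meas1 iw); exact: integrable_fin_num.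
exact: Rintegral_EFin.
Qed.

Lemma measurable_energy w : measurable_fun setT w -> measurable_fun setT (energy s w).
Proof. by move=> mw; rewrite /energy; have ms' := ms; meas. Qed.

Lemma F0_finite_energy v : F0 mu k v -> finite_energy v.
Proof.
move=> [hv [vE _]]; have [mv _] := hv; split => //; last exact: L2_integrable.
apply: integrable_ge0_lty; [exact: measurable_energy|exact: energy_ge0|].
rewrite (fubini_tonelli1 (EFin \o energy s v)).
- by move: vE; rewrite EformE_energy.
- by apply/measurable_EFinP; exact: measurable_energy.
- by move=> p; rewrite lee_fin energy_ge0.
Qed.

Lemma finite_energyB v w : finite_energy v -> finite_energy w ->
  finite_energy (fun x => v x - w x).
Proof.
move=> [mv iv jv] [mw iw jw].
have mvw : measurable_fun setT (fun x => v x - w x) by exact: measurable_funB.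
split => //.
- apply: (integrable_le _ _ (integrableZ_EFin 2 (integrableD_EFin iv iw))).
    exact: measurable_energy.
  move=> p; rewrite ger0_norm ?energy_ge0// /energy -mulrDl mulrA ler_wpM2r//.
  by have := sqr_ge0 ((v p.1 - v p.2) + (w p.1 - w p.2)); nra.
- apply: (integrable_le _ _ (integrableZ_EFin 2 (integrableD_EFin jv jw))).
    exact: measurable_funX.
  move=> x; rewrite ger0_norm ?sqr_ge0//.
  by have := sqr_ge0 (v x + w x); nra.
Qed.

Lemma energy_norm2_le v w : finite_energy v -> finite_energy w ->
  energy_norm2 v <= 2 * energy_norm2 (fun x => v x - w x) + 2 * energy_norm2 w.
Proof.
move=> hv hw; have [mv iv jv] := hv; have [mw iw jw] := hw.
have [mb ib jb] := finite_energyB hv hw.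
have h1 : Rintegral pi setT (energy s v) <=
    2 * (Rintegral pi setT (energy s (fun x => v x - w x)) + Rintegral pi setT (energy s w)).
  rewrite -RintegralD// -RintegralZl//; last exact: integrableD_EFin.
  apply: le_Rintegral => //; first by exact: integrableZ_EFin (integrableD_EFin ib iw).
  move=> p _; rewrite /energy -mulrDl mulrA ler_wpM2r//.
  by have := sqr_ge0 (v p.1 - v p.2 - 2 * (w p.1 - w p.2)); nra.
have h2 : Rintegral mu setT (fun x => v x ^+ 2) <=
    2 * (Rintegral mu setT (fun x => (v x - w x) ^+ 2) + Rintegral mu setT (fun x => w x ^+ 2)).
  rewrite -RintegralD// -RintegralZl//; last exact: integrableD_EFin.
  apply: le_Rintegral => //; first by exact: integrableZ_EFin (integrableD_EFin jb jw).
  by move=> x _; have := sqr_ge0 (v x - 2 * w x); nra.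
by rewrite /energy_norm2 !mulrDr addrACA -mulrDr -mulrDr; exact: lerD.
Qed.

Definition cross_form u v : R :=
  Rintegral pi setT (fun p => (u p.1 - u p.2) * (v p.1 - v p.2) * s p.1 p.2).
Definition asym_form u v : R :=
  Rintegral pi setT (fun p => (u p.1 - u p.2) * v p.2 * a p.1 p.2).

Lemma cross_form_integrable u v : finite_energy u -> finite_energy v ->
  pi.-integrable setT (EFin \o
    (fun p : V * V => (u p.1 - u p.2) * (v p.1 - v p.2) * s p.1 p.2)) /\
  cross_form u v ^+ 2 <= Rintegral pi setT (energy s u) * Rintegral pi setT (energy s v).
Proof. by move=> [mu_ iu _] [mv iv _]; exact: energy_cross. Qed.

Lemma asym_form_integrable u v : finite_energy u -> finite_energy v ->
  pi.-integrable setT (EFin \o (fun p : V * V => (u p.1 - u p.2) * v p.2 * a p.1 p.2)) /\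
  asym_form u v ^+ 2 <= Rintegral pi setT (energy s u) *
    (M * Rintegral mu setT (fun x => v x ^+ 2)).
Proof.
move=> [mu_ iu _] [mv iv jv].
exact: (antisymmetric_form ms s_ge0 (@ks_sym _ _ _) ma (@ka_anti _ _ _) a_le M_ge0 a_int).
Qed.

Lemma eta_lipE u v : finite_energy u -> finite_energy v ->
  eta_lip mu k u v = 2^-1 * cross_form u v + asym_form u v.
Proof.
move=> hu hv; rewrite /eta_lip EformE asym_formE.
have [i1 _] := cross_form_integrable hu hv.
have [i2 _] := asym_form_integrable hu hv.
by rewrite (Rintegral_fubini i1) (Rintegral_fubini i2) mulrC.
Qed.

Lemma eta_lipB u w v : finite_energy u -> finite_energy w -> finite_energy v ->
  eta_lip mu k u v - eta_lip mu k w v = eta_lip mu k (fun x => u x - w x) v.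
Proof.
move=> hu hw hv; have hb := finite_energyB hu hw.
rewrite !eta_lipE//.
have [i1 _] := cross_form_integrable hu hv; have [i2 _] := cross_form_integrable hw hv.
have [j1 _] := asym_form_integrable hu hv; have [j2 _] := asym_form_integrable hw hv.
have -> : cross_form (fun x => u x - w x) v = cross_form u v - cross_form w v.
  by rewrite /cross_form -RintegralB//; apply: eq_Rintegral => p _; ring.
have -> : asym_form (fun x => u x - w x) v = asym_form u v - asym_form w v.
  by rewrite /asym_form -RintegralB//; apply: eq_Rintegral => p _; ring.
by ring.
Qed.

(** With c the cross form and b the antisymmetric one, (c/2 + b)^2 <= 2 c^2 + 2 b^2, where c^2 <=
    E(u) E(v) and b^2 <= M E(u) |v|^2; hence the constant 2 (1 + M). *)
Lemma eta_lip_bound u v : finite_energy u -> finite_energy v ->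
  eta_lip mu k u v ^+ 2 <= 2 * (1 + M) * energy_norm2 u * energy_norm2 v.
Proof.
move=> hu hv; rewrite eta_lipE//.
have [_ b1] := cross_form_integrable hu hv; have [_ b2] := asym_form_integrable hu hv.
move: b1 b2; rewrite /energy_norm2.
have := Rintegral_energy_ge0 u; have := Rintegral_energy_ge0 v.
have := Rintegral_sqr_ge0 u; have := Rintegral_sqr_ge0 v.
set a1 := Rintegral mu _ _; set a2 := Rintegral mu _ _.
set e1 := Rintegral pi _ _; set e2 := Rintegral pi _ _.
set c := cross_form u v; set b := asym_form u v.
move=> h1 h2 h3 h4 b1 b2.
have e21 := mulr_ge0 h4 h3.
have e2a := mulr_ge0 h4 h1.
have a2e := mulr_ge0 h2 h3.
have a2a := mulr_ge0 h2 h1.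
have m1 := mulr_ge0 M_ge0 e21; have m2 := mulr_ge0 M_ge0 e2a.
have m3 := mulr_ge0 M_ge0 a2e; have m4 := mulr_ge0 M_ge0 a2a.
have cb : (2^-1 * c + b) ^+ 2 <= 2 * (c ^+ 2 + b ^+ 2).
  by have := sqr_ge0 (2^-1 * c - b); have := sqr_ge0 c; nra.
apply: le_trans cb _; lra.
Qed.

Lemma finite_energy_conv us u : (forall j, finite_energy (us j)) -> finite_energy u ->
  Fconv mu k us u -> forall e, 0 < e ->
  exists N, forall j, (N <= j)%N -> energy_norm2 (fun x => us j x - u x) < e.
Proof.
move=> hus hu h e e0; have [N hN] := h e e0; exists N => j /hN.
by rewrite Fnorm2E ?lte_fin//; exact: finite_energyB.
Qed.

(** Split eta(us_j, vs_j) = eta(us_j - u, vs_j) + eta(u, vs_j). The first term tends to 0 by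
    [eta_lip_bound], as the vs_j stay bounded in energy norm; the second is -<f, vs_j>, which
    converges by Cauchy-Schwarz in L^2. *)
Lemma form_limit u f v us vs :
  finite_energy u -> finite_energy v -> L2 mu f ->
  (forall j, finite_energy (us j)) -> (forall j, finite_energy (vs j)) ->
  (forall j, eta_lip mu k u (vs j) = - Rintegral mu setT (fun x => f x * vs j x)) ->
  Fconv mu k us u -> Fconv mu k vs v ->
  eta_lip mu k (us j) (vs j) @[j --> \oo] --> - Rintegral mu setT (fun x => f x * v x).
Proof.
move=> hu hv hf hus hvs ident cu cv; apply/cvgrPdist_lt => e e0.
have [mf _] := hf; have if2 := L2_integrable hf; have [mv _ jv] := hv.
pose L := Rintegral mu setT (fun x => f x ^+ 2).
have L0 : 0 <= L by exact: Rintegral_sqr_ge0.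
have nv0 := energy_norm2_ge0 v.
(* By [energy_norm2_le] this bounds the squared norm of vs_j as soon as vs_j - v has squared norm at
   most 1, which is why [d] is capped at 1. *)
pose B := 2 * (1 + energy_norm2 v).
(* The constant required by [abs_sub_lt] with P = L, from the L^2 pairing, and Q = 2 (1 + M) B, from
   the form. *)
pose C := 2 * (L + 2 * (1 + M) * B) + 1.
have C0 : 0 < C.
  by rewrite ltr_wpDl// mulr_ge0// addr_ge0// !mulr_ge0// addr_ge0.
pose d := Num.min 1 (e ^+ 2 / C).
have d0 : 0 < d by rewrite lt_min ltr01 divr_gt0// exprn_gt0.
have d1 : d <= 1 by rewrite /d ge_min lexx.
have dC : d * C <= e ^+ 2 by rewrite -ler_pdivlMr// /d ge_min lexx orbT.
have [N1 h1] := finite_energy_conv hus hu cu d0.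
have [N2 h2] := finite_energy_conv hvs hv cv d0.
exists (maxn N1 N2) => // j /=; rewrite geq_max => /andP[/h1 w1 /h2 w2].
have hw := finite_energyB (hus j) hu; have hz := finite_energyB (hvs j) hv.
have vB : energy_norm2 (vs j) <= B.
  by apply: le_trans (energy_norm2_le (hvs j) hv) _; rewrite /B; lra.
have b1 := eta_lip_bound hw (hvs j).
have [_ _ jz] := hz; have [mz _ _] := hz; have [mvs _ jvs] := hvs j.
have [_ b2] := cauchy_schwarz mf mz if2 jz.
have [i1 _] := cauchy_schwarz mf mvs if2 jvs; have [i2 _] := cauchy_schwarz mf mv if2 jv.
have E : - Rintegral mu setT (fun x => f x * v x) - eta_lip mu k (us j) (vs j) =
    Rintegral mu setT (fun x => f x * (vs j x - v x)) - eta_lip mu k (fun x => us j x - u x) (vs j).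
  rewrite -eta_lipB// ident.
  have -> : Rintegral mu setT (fun x => f x * (vs j x - v x)) =
      Rintegral mu setT (fun x => f x * vs j x) - Rintegral mu setT (fun x => f x * v x).
    by rewrite -RintegralB//; apply: eq_Rintegral => x _; ring.
  by ring.
have zd : Rintegral mu setT (fun x => (vs j x - v x) ^+ 2) <= d.
  apply: le_trans (ltW w2); rewrite /energy_norm2 lerDr; exact: Rintegral_energy_ge0.
have X2 := le_trans b2 (ler_wpM2l L0 zd).
have M1 := mulr_ge0 (ler0n R 2) (addr_ge0 ler01 M_ge0).
have Y2 := le_trans b1 (scaled_product_le M1 (energy_norm2_ge0 _) (ltW w1)
  (energy_norm2_ge0 _) vB).
by rewrite E; exact: (abs_sub_lt e0 d0 X2 Y2 dC).
Qed.
End form_continuity.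

Section hypotheses_off_diagonal.
Context (R : realType) (n : nat).
Local Notation V := 'rV[R]_n.
Variable mu : {sigma_finite_measure set V -> \bar R}.
Variable k : V -> V -> R.
Local Notation s := (ks (offdiag k)).
Local Notation a := (ka (offdiag k)).

Lemma levy_offdiag x :
  (\int[mu]_(y in [set y | y != x]) (Num.min 1 (enorm (y - x) ^+ 2) * ks k x y)%:E =
   \int[mu]_y (Num.min 1 (enorm (y - x) ^+ 2) * s x y)%:E)%E.
Proof.
apply: integral_extend => y /=; first by move=> yx; rewrite ks_offdiag.
by move=> /negP; rewrite negbK => /eqP ->; rewrite ks_diag mulr0.
Qed.

Lemma jump_offdiag x :
  (\int[mu]_(z in [set z | (0 < enorm z <= 1)%R])
     (enorm z * `|ks k x (x + z) - ks k x (x - z)|)%:E =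
   \int[mu]_z (unit_indic z * (enorm z * `|s x (x + z) - s x (x - z)|))%:E)%E.
Proof.
have xz (z : V) : z != 0 -> x + z != x.
  by rewrite -[x + z == x]subr_eq0 addrAC subrr add0r.
apply: integral_extend => z /=.
  move=> /andP[z0 z1]; have zn0 : z != 0 by rewrite -enorm_eq0 gt_eqF.
  have z2 : - z != 0 by rewrite oppr_eq0.
  by rewrite /unit_indic z1 mul1r (ks_offdiag k (xz _ zn0)) (ks_offdiag k (xz _ z2)).
move=> /negP; rewrite negb_and -leNgt -ltNge => /orP[z0|z1].
  by rewrite (_ : enorm z = 0) ?mul0r ?mulr0//; apply/eqP; rewrite eq_le z0 enorm_ge0.
by rewrite /unit_indic leNgt z1 mul0r.
Qed.

Lemma tail_offdiag x :
  (\int[mu]_(y in [set y | (1 <= enorm (y - x))%R]) (ks k x y)%:E =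
   \int[mu]_y (far_indic (y - x) * s x y)%:E)%E.
Proof.
apply: integral_extend => y /=.
  move=> y1; rewrite /far_indic y1 mul1r ks_offdiag//.
  by rewrite -subr_eq0 -enorm_eq0 gt_eqF// (lt_le_trans _ y1).
by move=> /negP/negbTE; rewrite /far_indic => ->; rewrite mul0r.
Qed.

Lemma ratio_offdiag x :
  (\int[mu]_(y in [set y | y != x /\ (ks k x y != 0)%R]) ((ka k x y) ^+ 2 / ks k x y)%:E =
   \int[mu]_y (a x y ^+ 2 / s x y)%:E)%E.
Proof.
apply: integral_extend => y /=; first by move=> [yx _]; rewrite ks_offdiag// ka_offdiag.
move=> h; have [->|yx] := eqVneq y x; first by rewrite ks_diag invr0 mulr0.
have [s0|s0] := eqVneq (ks k x y) 0; last by case: h.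
by rewrite -ks_offdiag// s0 invr0 mulr0.
Qed.
End hypotheses_off_diagonal.

(** Here the hypotheses on k are transferred to the modified kernel and to the product measure, for
    which [mu] must carry its sigma-finite structure. *)
Lemma generator_sigma_finite (R : realType) (n : nat)
  (mu : {sigma_finite_measure set 'rV[R]_n -> \bar R}) (k : 'rV[R]_n -> 'rV[R]_n -> R)
  (Hmu : is_lebesgue mu)
  (Hk0 : forall x y, x != y -> 0 <= k x y)
  (Hkm : measurable_fun [set p : 'rV[R]_n * 'rV[R]_n | p.1 != p.2]
           (fun p => k p.1 p.2))
  (H1 : L2loc mu (fun x => \int[mu]_(y in [set y | y != x])
           (Num.min 1 (enorm (y - x) ^+ 2) * ks k x y)%:E)%E)
  (H2 : L2loc mu (fun x => \int[mu]_(z in [set z | (0 < enorm z <= 1)%R])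
           (enorm z * `|ks k x (x + z) - ks k x (x - z)|)%:E)%E)
  (H3 : let g := (fun x => \int[mu]_(y in [set y | (1 <= enorm (y - x))%R])
           (ks k x y)%:E)%E in L2e mu g \/ Linfty mu g)
  (H4 : exists M : R, forall x,
     (\int[mu]_(y in [set y | y != x /\ (ks k x y != 0)%R])
        ((ka k x y) ^+ 2 / ks k x y)%:E <= M%:E)%E) :
  forall u : 'rV[R]_n -> R, C2c u -> generator_value mu k u (Lformula mu k u).
Proof.
move=> u hu.
have ms := measurable_ks Hkm; have ma := measurable_ka Hkm.
have s0 := ks_ge0 Hk0; have sS := @ks_sym R n k; have sD := @ks_diag R n k.
have aA := @ka_anti R n k; have aL := ka_le Hk0.
have [M [M0 aM]] : exists M : R, 0 < M /\ forall x,
    (\int[mu]_y (ka (offdiag k) x y ^+ 2 / ks (offdiag k) x y)%:E <= M%:E)%E.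
  (* The maximum with 1 makes the constant strictly positive, as [L2_antisymmetric_part] needs on
     slices of infinite energy. *)
  have [M hM] := H4; exists (Num.max M 1); split; first by rewrite lt_max ltr01 orbT.
  move=> x; rewrite -ratio_offdiag; apply: le_trans (hM x) _.
  by rewrite lee_fin le_max lexx.
have levy_loc r : (\int[mu]_(x in [set x : 'rV[R]_n | (enorm x <= r)%R])
    ((\int[mu]_y (Num.min 1 (enorm (y - x) ^+ 2) * ks (offdiag k) x y)%:E) *
     (\int[mu]_y (Num.min 1 (enorm (y - x) ^+ 2) * ks (offdiag k) x y)%:E)) < +oo)%E.
  by have := H1.2 r; under eq_integral do rewrite levy_offdiag.
have jump_loc r : (\int[mu]_(x in [set x : 'rV[R]_n | (enorm x <= r)%R])
    ((\int[mu]_z (unit_indic z * (enorm z *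
        `|ks (offdiag k) x (x + z) - ks (offdiag k) x (x - z)|))%:E) *
     (\int[mu]_z (unit_indic z * (enorm z *
        `|ks (offdiag k) x (x + z) - ks (offdiag k) x (x - z)|))%:E)) < +oo)%E.
  by have := H2.2 r; under eq_integral do rewrite jump_offdiag.
have tail : L2e mu (fun x => \int[mu]_y (far_indic (y - x) * ks (offdiag k) x y)%:E)%E \/
    exists N : R, {ae mu, forall x,
      (\int[mu]_y (far_indic (y - x) * ks (offdiag k) x y)%:E <= N%:E)%E}.
  case: H3 => /= [[mg hg]|[_ [N hN]]]; [left|right; exists N].
    split; last by under eq_integral do rewrite -tail_offdiag.
    by apply: eq_measurable_fun mg => x _; rewrite tail_offdiag.
  move: hN; apply: filterS => x; rewrite tail_offdiag; apply: le_trans; exact: lee_abs.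
have mi : measurable_fun setT (@unit_indic R n) by apply: measurable_unit_indic; meas.
have levy_int : forall r, (mu \x mu)%E.-integrable setT (EFin \o (fun p : 'rV[R]_n * 'rV[R]_n =>
    ball_indic r p.1 * (Num.min 1 (enorm (p.2 - p.1) ^+ 2) * ks (offdiag k) p.1 p.2))).
  move=> r; apply: (@locally_square_integrable _ _ _ Hmu
    (fun p => Num.min 1 (enorm (p.2 - p.1) ^+ 2) * ks (offdiag k) p.1 p.2)) => //.
    by meas.
  by move=> p; rewrite mulr_ge0// le_min ler01 sqr_ge0.
have jump_int : forall r, (mu \x mu)%E.-integrable setT (EFin \o (fun p : 'rV[R]_n * 'rV[R]_n =>
    ball_indic r p.1 * (unit_indic p.2 * (enorm p.2 *
    `|ks (offdiag k) p.1 (p.1 + p.2) - ks (offdiag k) p.1 (p.1 - p.2)|)))).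
  move=> r; apply: (@locally_square_integrable _ _ _ Hmu
    (fun p => unit_indic p.2 * (enorm p.2 *
    `|ks (offdiag k) p.1 (p.1 + p.2) - ks (offdiag k) p.1 (p.1 - p.2)|))) => //.
    by meas.
  by move=> p; rewrite !mulr_ge0 ?unit_indic_ge0 ?enorm_ge0.
have fe w : Cc_lip w -> finite_energy mu k w.
  move=> hw; split; first exact: Cc_lip_measurable.
    exact: energy_integrable.
  exact: Cc_lip_square_integrable.
have feu := fe _ (C2c_Cc_lip hu).
have EL : Lformula mu k u = operator mu (ks (offdiag k)) (ka (offdiag k)) u.
  by apply/funext => x; exact: LformulaE.
have hL : L2 mu (Lformula mu k u).
  rewrite EL; exact: (L2_operator Hmu ms s0 sS ma aL levy_loc jump_loc tail M0 aM).
split; last split => // [v hv us vs hus hvs cu cv].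
  have [mu_ iu ju] := feu; split; last split.
  - by split => //; rewrite Rintegral_EFin// ltry.
  - rewrite EformE_energy; apply: nonneg_iterated_lty => // p; exact: energy_ge0.
  (* Since u itself is in C_c^lip, the constant sequence approximates it. *)
  - exists (fun=> u); split=> [_|e e0]; first exact: C2c_Cc_lip.
    exists 0%N => m _; rewrite Fnorm2E//; last exact: finite_energyB.
    rewrite lte_fin /energy_norm2 /energy.
    rewrite (_ : (fun _ => _) = cst 0); last by apply/funext => p; rewrite !subrr expr0n /= mul0r.
    rewrite (_ : (fun _ => _) = cst 0); last by apply/funext => p; rewrite subrr expr0n.
    by rewrite /Rintegral !integral0 addr0.
apply: (form_limit Hk0 Hkm (ltW M0) aM feu (F0_finite_energy Hk0 Hkm hv) hL) cu cv.
- by move=> j; exact: fe.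
- by move=> j; exact: fe.
move=> j; rewrite (eta_lipE Hk0 Hkm (ltW M0) aM)//; last exact: fe.
rewrite EL.
exact: (weak_identity Hmu ms s0 sS sD ma aA aL levy_int jump_int (ltW M0) aM hu (hvs j)).2.
Qed.

Theorem theorem1p3 (R : realType) (n : nat)
  (mu : {measure set 'rV[R]_n -> \bar R}) (k : 'rV[R]_n -> 'rV[R]_n -> R)
  (Hmu : is_lebesgue mu)
  (Hk0 : forall x y, x != y -> 0 <= k x y)
  (Hkm : measurable_fun [set p : 'rV[R]_n * 'rV[R]_n | p.1 != p.2]
           (fun p => k p.1 p.2))
  (H1 : L2loc mu (fun x => \int[mu]_(y in [set y | y != x])
           (Num.min 1 (enorm (y - x) ^+ 2) * ks k x y)%:E)%E)
  (H2 : L2loc mu (fun x => \int[mu]_(z in [set z | (0 < enorm z <= 1)%R])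
           (enorm z * `|ks k x (x + z) - ks k x (x - z)|)%:E)%E)
  (H3 : let g := (fun x => \int[mu]_(y in [set y | (1 <= enorm (y - x))%R])
           (ks k x y)%:E)%E in L2e mu g \/ Linfty mu g)
  (H4 : exists M : R, forall x,
     (\int[mu]_(y in [set y | y != x /\ (ks k x y != 0)%R])
        ((ka k x y) ^+ 2 / ks k x y)%:E <= M%:E)%E)
  (H5 : forall x, (\int[mu]_(y in [set y | (0 < enorm (x - y) <= 1)%R])
        (enorm (x - y) * `|ka k x y|)%:E < +oo)%E) :
  forall u : 'rV[R]_n -> R, C2c u ->
    exists Lu : 'rV[R]_n -> R, generator_value mu k u Lu /\
      {ae mu, forall x, Lu x = Lformula mu k u x}.
Proof.
move=> u hu; have [m mE] := sigma_finite_pack Hmu.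
(* The formula is itself chosen as the representative of Lu, so the almost everywhere equality holds
   at every point. *)
exists (Lformula mu k u); split; last exact: aeW.
move: Hmu H1 H2 H3 H4; rewrite -mE => Hmu' H1' H2' H3' H4'.
exact: (@generator_sigma_finite R n m k Hmu' Hk0 Hkm H1' H2' H3' H4' u hu).
Qed.
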